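(* Let $U_{AB}$ be a unitary with $(\lambda_1,\lambda_2)$-controllable correlation. If a non-local quantum computation protocol using a pure resource state $|\Psi\rangle_{LR}$ gives an $\epsilon$-correct (in diamond norm distance, with $\epsilon<1/4$) implementation of $U_{AB}$, then \[ S(R)_\Psi\ \ge\ \frac{\lambda_1-\lambda_2}{2}-\Delta(2\sqrt{\epsilon},n_A),\qquad \Delta(x,n)=4nx+(1+2x)\,h\!\left(\frac{2x}{1+2x}\right). \]
   Context: A non-local quantum computation (NLQC) implementing a channel on $AB$ (with $A$ input and output on Alice's side and $B$ on Bob's side) is a channel of the form $(\mathcal{W}_{K_aM_a\to A}\otimes\mathcal{W}'_{K_bM_b\to B})\circ(\mathcal{V}_{AL\to K_aM_b}\otimes\mathcal{V}'_{RB\to M_aK_b})(\cdot\otimes\Psi_{LR})$ with shared resource state $\Psi_{LR}$ ($L$ Alice, $R$ Bob): local operations, one simultaneous round of quantum communication, local operations. It is an $\epsilon$-correct implementation of $U$ if its diamond-norm distance to $\rho\mapsto U\rho U^\dagger$ is at most $\epsilon$, where $\|\mathcal{N}-\mathcal{M}\|_\diamond=\sup_d\max_\Psi\|(\mathrm{id}_d\otimes\mathcal{N})(\Psi)-(\mathrm{id}_d\otimes\mathcal{M})(\Psi)\|_1$, $\|X\|_1=\mathrm{tr}|X|$. $S$ is von Neumann entropy (base 2), $I(X:Y)=S(X)+S(Y)-S(XY)$, $h(x)=-x\log x-(1-x)\log(1-x)$, and $n_A=\log_2\dim\mathcal{H}_A$. Controllable correlation: let $\bar Q$ be a reference system with $n_{\bar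 Q}=n_A$. For a state $P_{\bar QA}$ and states $\phi^1_B,\phi^2_B$ define $\rho^i_{\bar QAB}=U_{AB}(P_{\bar QA}\otimes\phi^i_B)U_{AB}^\dagger$. $U_{AB}$ has $(\lambda_1,\lambda_2)$-controllable correlation if there exist $P_{\bar QA},\phi^1_B,\phi^2_B$ with $\lambda_1=I(\bar Q:A)_{\rho^1}$, $\lambda_2=I(\bar Q:A)_{\rho^2}$ and $\lambda_1>\lambda_2$. *)

(* Defs.v *)
From HB Require Import structures.
From mathcomp Require Import all_boot all_order all_algebra.
From mathcomp Require Import reals exp.
From mathcomp Require Import complex.
From Stdlib Require Import ClassicalEpsilon.

Set Implicit Arguments.
Unset Strict Implicit.
Unset Printing Implicit Defensive.

Import Order.TTheory GRing.Theory Num.Theory.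
Local Open Scope ring_scope.

Section QuantumDefs.
Variable R : realType.
Local Notation C := (R[i]).

Definition log2 (x : R) : R := ln x / ln 2.
Definition eta (x : R) : R := if x == 0 then 0 else - (x * log2 x).
Definition hbin (x : R) : R := eta x + eta (1 - x).
Definition Delta (x n : R) : R :=
  4 * n * x + (1 + 2 * x) * hbin (2 * x / (1 + 2 * x)).

(* ---------- Operators on finite-dimensional Hilbert spaces ----------
   A system is a finite type I (its computational basis); an operator
   C^J -> C^I is a matrix mx I J. Composite systems are product types. *)
Definition mx (I J : finType) := I -> J -> C.
Arguments mx (I J)%_type_scope.

Definition mxmul (I J K : finType) (X : mx I J) (Y : mx J K) : mx I K :=
  fun i k => \sum_(j : J) X i j * Y j k.
Definition adj (I J : finType) (X : mx I J) : mx J I := fun j i => (X i j)^*.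
Definition idm (I : finType) : mx I I := fun i j => (i == j)%:R.
Definition mtrace (I : finType) (X : mx I I) : C := \sum_(i : I) X i i.
Definition diagm (I : finType) (l : I -> C) : mx I I :=
  fun i j => (i == j)%:R * l i.
Definition msub (I J : finType) (X Y : mx I J) : mx I J :=
  fun i j => X i j - Y i j.

Definition unitary (I : finType) (U : mx I I) : Prop := mxmul (adj U) U = @idm I.

(* positive semidefinite: <v, X v> is real and nonnegative for every v
   (in R[i], 0 <= z means that z is real and nonnegative) *)
Definition psd (I : finType) (X : mx I I) : Prop :=
  forall v : I -> C, 0 <= \sum_(i : I) \sum_(j : I) (v i)^* * X i j * v j.

Definition state (I : finType) (X : mx I I) : Prop := psd X /\ mtrace X = 1.

Definition pure (I : finType) (psi : I -> C) : mx I I := fun i j => psi i * (psi j)^*.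
Definition unit_vector (I : finType) (psi : I -> C) : Prop :=
  \sum_(i : I) (psi i)^* * psi i = 1.

Definition kron (I J I' J' : finType) (X : mx I I') (Y : mx J J') :
  mx (I * J) (I' * J') := fun p q => X p.1 q.1 * Y p.2 q.2.

Definition ptr2 (I J : finType) (X : mx (I * J) (I * J)) : mx I I :=
  fun i i' => \sum_(j : J) X (i, j) (i', j).
Definition ptr1 (I J : finType) (X : mx (I * J) (I * J)) : mx J J :=
  fun j j' => \sum_(i : I) X (i, j) (i, j').

Definition spectrum (I : finType) (X : mx I I) (l : I -> R) : Prop :=
  exists U : mx I I, unitary U /\
    X = mxmul (mxmul U (diagm (fun i => (l i)%:C%C))) (adj U).
(* S(X) = - sum_i l_i log2 l_i over the eigenvalues of X (a choice of
   spectrum is unique up to permutation, so the sum is well defined) *)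
Definition entropy (I : finType) (X : mx I I) : R :=
  let l := epsilon (inhabits (fun _ : I => 0 : R)) (spectrum X) in
  \sum_(i : I) eta (l i).

Definition svals (I : finType) (X : mx I I) (s : I -> R) : Prop :=
  (forall i, 0 <= s i) /\
  exists U V : mx I I, [/\ unitary U, unitary V &
    X = mxmul (mxmul U (diagm (fun i => (s i)%:C%C))) V].
Definition trnorm (I : finType) (X : mx I I) : R :=
  let s := epsilon (inhabits (fun _ : I => 0 : R)) (svals X) in
  \sum_(i : I) s i.

Definition mutinfo (Q A B : finType) (rho : mx ((Q * A) * B) ((Q * A) * B)) : R :=
  let rQA := ptr2 rho in entropy (ptr2 rQA) + entropy (ptr1 rQA) - entropy rQA.

Definition lmap (I J : finType) := mx I I -> mx J J.
Arguments lmap (I J)%_type_scope.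

Definition islinear (I J : finType) (N : lmap I J) : Prop :=
  forall (a : C) (X Y : mx I I),
    N (fun i j => a * X i j + Y i j) = (fun i j => a * N X i j + N Y i j).

Definition ebasis (I : finType) (i i' : I) : mx I I :=
  fun a b => ((a == i) && (b == i'))%:R.

(* tensor product N1 (x) N2 of linear maps, defined by linearity on the
   product basis |i><i'| (x) |j><j'| *)
Definition tensmap (I J I' J' : finType) (N1 : lmap I J) (N2 : lmap I' J') :
  lmap (I * I') (J * J') :=
  fun X p q => \sum_(i : I) \sum_(i' : I) \sum_(j : I') \sum_(j' : I')
     X (i, j) (i', j') * N1 (ebasis i i') p.1 q.1 * N2 (ebasis j j') p.2 q.2.

Definition idmap (I : finType) : lmap I I := fun X => X.

Definition completely_positive (I J : finType) (N : lmap I J) : Prop :=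
  forall (d : nat) (X : mx ('I_d * I) ('I_d * I)),
    psd X -> psd (tensmap (@idmap 'I_d) N X).
Definition trace_preserving (I J : finType) (N : lmap I J) : Prop :=
  forall X : mx I I, mtrace (N X) = mtrace X.
Definition channel (I J : finType) (N : lmap I J) : Prop :=
  [/\ islinear N, completely_positive N & trace_preserving N].

Definition uchan (I : finType) (U : mx I I) : lmap I I :=
  fun rho => mxmul (mxmul U rho) (adj U).

Definition diamond_close (I J : finType) (N M : lmap I J) (eps : R) : Prop :=
  forall (d : nat) (X : mx ('I_d * I) ('I_d * I)),
    state X ->
    trnorm (msub (tensmap (@idmap 'I_d) N X) (tensmap (@idmap 'I_d) M X)) <= eps.

(* rho_{AB} (x) Psi_{LR} regrouped as (A L) (R B) *)
Definition nlqc_in (A B L Rr : finType) (rho : mx (A * B) (A * B))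
  (Psi : mx (L * Rr) (L * Rr)) : mx ((A * L) * (Rr * B)) ((A * L) * (Rr * B)) :=
  fun p q => rho (p.1.1, p.2.2) (q.1.1, q.2.2) * Psi (p.1.2, p.2.1) (q.1.2, q.2.1).
(* the communication round: (K_a M_b)(M_a K_b) regrouped as (K_a M_a)(K_b M_b) *)
Definition nlqc_comm (Ka Ma Kb Mb : finType)
  (X : mx ((Ka * Mb) * (Ma * Kb)) ((Ka * Mb) * (Ma * Kb))) :
  mx ((Ka * Ma) * (Kb * Mb)) ((Ka * Ma) * (Kb * Mb)) :=
  fun p q => X ((p.1.1, p.2.2), (p.1.2, p.2.1)) ((q.1.1, q.2.2), (q.1.2, q.2.1)).
Definition nlqc (A B L Rr Ka Ma Kb Mb : finType) (Psi : mx (L * Rr) (L * Rr))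
  (V : lmap (A * L) (Ka * Mb)) (V' : lmap (Rr * B) (Ma * Kb))
  (W : lmap (Ka * Ma) A) (W' : lmap (Kb * Mb) B) : lmap (A * B) (A * B) :=
  fun rho => tensmap W W' (nlqc_comm (tensmap V V' (nlqc_in rho Psi))).

(* rho = (1_Qbar (x) U_AB) (P_{Qbar A} (x) phi_B) (1_Qbar (x) U_AB)^dagger,
   with Qbar a copy of A (so n_Qbar = n_A) *)
Definition evolve (A B : finType) (U : mx (A * B) (A * B)) (P : mx (A * A) (A * A))
  (phi : mx B B) : mx ((A * A) * B) ((A * A) * B) :=
  let W : mx ((A * A) * B) ((A * A) * B) :=
    fun p q => (p.1.1 == q.1.1)%:R * U (p.1.2, p.2) (q.1.2, q.2) in
  mxmul (mxmul W (kron P phi)) (adj W).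

Definition controllable_correlation (A B : finType) (U : mx (A * B) (A * B))
  (l1 l2 : R) : Prop :=
  exists (P : mx (A * A) (A * A)) (phi1 phi2 : mx B B),
    [/\ state P, state phi1 & state phi2] /\
    [/\ l1 = mutinfo (evolve U P phi1),
        l2 = mutinfo (evolve U P phi2) & l2 < l1].

End QuantumDefs.

Arguments mx R (I J)%_type_scope.
Arguments lmap R (I J)%_type_scope.

(* Main.v *)
Require Import Defs.
From HB Require Import structures.
From mathcomp Require Import all_boot all_order all_algebra.
From mathcomp Require Import boolp classical_sets functions reals exp.
From mathcomp Require Import topology normedtype derive realfun.
From mathcomp Require Import ring lra.
From mathcomp Require Import complex spectral.

(** For a state on [Q * X] the conditional entropy [S(QX) - S(X)] equals
    [S(Q) - I(Q:X)], and the marginal on [Q] is never touched, so the two mutual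
    informations are compared through conditional entropies given Alice's system.

    After Alice's first operation let [c0] be the conditional entropy of [Q] given
    her kept message [K_a]; it does not depend on Bob's input.  Bob's operation,
    applied to [R] and his purified input, is an isometry on [R].  By strong
    subadditivity the conditional entropy given [K_a M_a] is at most [c0] and at
    least that given [K_a R], which is at least [c0 - 2 S(R)].  Alice's last
    operation, dilated by its environment [E], is an isometry [K_a M_a -> A E] and
    preserves conditional entropy.  Finally, since the protocol is close to a
    unitary on a pure input, its global output vector is close to the ideal output
    tensored with a fixed environment state, so the Alicki-Fannes-Winter bound
    replaces the value given [A E] by the ideal value given [A].  Using the upper
    bound for one input of Bob and the lower bound for the other gives the theorem.

    Strong subadditivity comes from monotonicity of relative entropy: for [t > 0],
    [<rho, (L_sg + t R_rho)^-1 rho>] is the supremum over [X] of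
    [2 Re tr(X^+ rho) - tr(X X^+ sg) - t tr(X^+ X rho)]; for the reduced operators
    only the [X] acting on the subsystem compete, so the value decreases, and
    integrating over [t] gives the logarithm.  Operators are positive matrices without normalisation,
    which turns concavity statements into superadditivity. *)

Set Implicit Arguments.
Unset Strict Implicit.
Unset Printing Implicit Defensive.

Import Order.TTheory GRing.Theory Num.Theory.
Local Open Scope ring_scope.

(** * Matrix algebra *)

Section MatrixAlgebra.
Local Open Scope sesquilinear_scope.
Variable R : realType.
Local Notation C := (R[i]).
Local Notation mx := (mx R).

Lemma mxext (I J : finType) (X Y : mx I J) : (forall i j, X i j = Y i j) -> X = Y.
Proof. by move=> h; apply/funext => i; apply/funext => j. Qed.

Lemma mxmulA (I J K L : finType) (X : mx I J) (Y : mx J K) (Z : mx K L) :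
  mxmul X (mxmul Y Z) = mxmul (mxmul X Y) Z.
Proof.
apply: mxext => i l; rewrite /mxmul.
under eq_bigr do rewrite mulr_sumr.
rewrite exchange_big; apply: eq_bigr => k _; rewrite mulr_suml.
by apply: eq_bigr => j _; rewrite mulrA.
Qed.

Lemma sum_pair (M : nmodType) (I J : finType) (F : I * J -> M) :
  \sum_p F p = \sum_i \sum_j F (i, j).
Proof. by rewrite pair_bigA; apply: eq_bigr => -[]. Qed.

Lemma sum_deltal (I : finType) (F : I -> C) (i : I) :
  \sum_j (i == j)%:R * F j = F i.
Proof.
rewrite (bigD1 i) //= eqxx mul1r big1 ?addr0 // => j /negPf.
by rewrite eq_sym => ->; rewrite mul0r.
Qed.

Lemma sum_deltar (I : finType) (F : I -> C) (i : I) :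
  \sum_j F j * (j == i)%:R = F i.
Proof. by rewrite -[RHS]sum_deltal; apply: eq_bigr => j _; rewrite mulrC eq_sym. Qed.

Lemma mxmul1l (I J : finType) (X : mx I J) : mxmul (@idm R I) X = X.
Proof. by apply: mxext => i j; rewrite /mxmul /idm sum_deltal. Qed.

Lemma mxmul1r (I J : finType) (X : mx I J) : mxmul X (@idm R J) = X.
Proof. by apply: mxext => i j; rewrite /mxmul /idm sum_deltar. Qed.

Lemma adjK (I J : finType) (X : mx I J) : adj (adj X) = X.
Proof. by apply: mxext => i j; rewrite /adj conjCK. Qed.

Lemma adjM (I J K : finType) (X : mx I J) (Y : mx J K) :
  adj (mxmul X Y) = mxmul (adj Y) (adj X).
Proof.
apply: mxext => i j; rewrite /adj /mxmul rmorph_sum.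
by apply: eq_bigr => k _; rewrite rmorphM mulrC.
Qed.

Lemma conj_real (x : R) : (x%:C%C : C)^* = x%:C%C.
Proof. exact: conjc_real. Qed.

Lemma conjCn (n : nat) : (n%:R : C)^* = n%:R.
Proof. exact: rmorph_nat. Qed.

Lemma conjM (x y : C) : (x * y)^* = x^* * y^*. Proof. exact: rmorphM. Qed.
Lemma conjD (x y : C) : (x + y)^* = x^* + y^*. Proof. exact: rmorphD. Qed.
Lemma conjB (x y : C) : (x - y)^* = x^* - y^*. Proof. exact: rmorphB. Qed.
Lemma conjN (x : C) : (- x)^* = - x^*. Proof. exact: rmorphN. Qed.
Lemma conj_sum (I : finType) (P : pred I) (F : I -> C) :
  (\sum_(i | P i) F i)^* = \sum_(i | P i) (F i)^*.
Proof. exact: rmorph_sum. Qed.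

Lemma adj_idm (I : finType) : adj (@idm R I) = @idm R I.
Proof. by apply: mxext => i j; rewrite /adj /idm conjCn eq_sym. Qed.

Lemma mul_diagr (I J : finType) (X : mx I J) (l : J -> C) i j :
  mxmul X (diagm l) i j = X i j * l j.
Proof.
rewrite /mxmul /diagm -[RHS](sum_deltar (fun k => X i k * l j)).
apply: eq_bigr => k _; rewrite mulrCA mulrC -mulrA.
by case: eqP => [->|]; rewrite ?mulr0 ?mulr1 // mulr0.
Qed.

Lemma mul_diagl (I J : finType) (X : mx I J) (l : I -> C) i j :
  mxmul (diagm l) X i j = l i * X i j.
Proof.
rewrite /mxmul /diagm -[RHS](sum_deltal (fun k => l i * X k j)).
by apply: eq_bigr => k _; rewrite mulrA.
Qed.

Lemma mtrace_mulC (I J : finType) (X : mx I J) (Y : mx J I) :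
  mtrace (mxmul X Y) = mtrace (mxmul Y X).
Proof.
rewrite /mtrace /mxmul exchange_big; apply: eq_bigr => j _.
by apply: eq_bigr => i _; rewrite mulrC.
Qed.

(** The squared modulus as an element of [R], so that weights and probabilities are ordered
    reals. *)
Definition nsq (z : C) : R := (complex.Re z) ^+ 2 + (complex.Im z) ^+ 2.

Lemma mul_conj (z : C) : z * z^* = ((nsq z)%:C)%C.
Proof. by rewrite -normCK add_Re2_Im2. Qed.

Lemma nsq_ge0 z : 0 <= nsq z.
Proof. by rewrite addr_ge0 ?sqr_ge0. Qed.

Lemma nsq_eq0 z : (nsq z == 0) = (z == 0).
Proof.
rewrite -(inj_eq (@complexI R)) -mul_conj.
by rewrite mulf_eq0 conjC_eq0 orbb.
Qed.

Lemma nsq_real (x : R) : nsq (x%:C)%C = x ^+ 2.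
Proof. by rewrite /nsq /= expr0n addr0. Qed.

Lemma real_sum (I : finType) (P : pred I) (F : I -> R) :
  ((\sum_(i | P i) F i)%:C)%C = \sum_(i | P i) ((F i)%:C)%C.
Proof. exact: (rmorph_sum (real_complex R)). Qed.

Lemma Re_sum (I : finType) (P : pred I) (F : I -> C) :
  complex.Re (\sum_(i | P i) F i) = \sum_(i | P i) complex.Re (F i).
Proof. by elim/big_rec2: _ => //= i x y _ <-; case: (F i) y => a b [c d]. Qed.

Lemma ReD (x y : C) : complex.Re (x + y) = complex.Re x + complex.Re y. Proof. by case: x y => a b []. Qed.
Lemma ReN (x : C) : complex.Re (- x) = - complex.Re x. Proof. by case: x. Qed.
Lemma ReB (x y : C) : complex.Re (x - y) = complex.Re x - complex.Re y. Proof. by rewrite ReD ReN. Qed.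
Lemma ReZ (a : R) (x : C) : complex.Re ((a%:C)%C * x) = a * complex.Re x.
Proof. by case: x => b c /=; rewrite mul0r subr0. Qed.

(** Enumerating the basis carries operators to library matrices and back; this gives access to the
    spectral theorem and to the equality of left and right inverses. *)
Definition toM (I J : finType) (X : mx I J) : 'M[C]_(#|I|, #|J|) :=
  \matrix_(i, j) X (enum_val i) (enum_val j).
Definition ofM (I J : finType) (X : 'M[C]_(#|I|, #|J|)) : mx I J :=
  fun i j => X (enum_rank i) (enum_rank j).

Lemma toMK (I J : finType) : cancel (@toM I J) (@ofM I J).
Proof. by move=> X; apply: mxext => i j; rewrite /ofM mxE !enum_rankK. Qed.

Lemma ofMK (I J : finType) : cancel (@ofM I J) (@toM I J).
Proof. by move=> X; apply/matrixP => i j; rewrite mxE /ofM !enum_valK. Qed.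

Lemma ofM_mul (I J K : finType) (X : 'M[C]_(#|I|, #|J|)) (Y : 'M[C]_(#|J|, #|K|)) :
  ofM (X *m Y) = mxmul (ofM X) (ofM Y).
Proof.
apply: mxext => i k; rewrite /ofM /mxmul mxE.
rewrite [RHS](reindex (@enum_val J predT)) /=; last first.
  by exists enum_rank => x _; rewrite ?enum_valK ?enum_rankK.
by apply: eq_bigr => j _; rewrite enum_valK.
Qed.

Lemma ofM_1 (I : finType) : ofM (1%:M : 'M[C]_(#|I|)) = @idm R I.
Proof. by apply: mxext => i j; rewrite /ofM mxE (inj_eq enum_rank_inj). Qed.

Lemma ofM_adj (I J : finType) (X : 'M[C]_(#|I|, #|J|)) :
  ofM (X ^t*) = adj (ofM X).
Proof. by apply: mxext => i j; rewrite /ofM /adj !mxE. Qed.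

Lemma toM_mul (I J K : finType) (X : mx I J) (Y : mx J K) :
  toM (mxmul X Y) = toM X *m toM Y.
Proof. by rewrite -[RHS]ofMK ofM_mul !toMK. Qed.

Lemma toM_1 (I : finType) : toM (@idm R I) = 1%:M.
Proof. by rewrite -ofM_1 ofMK. Qed.

Lemma mxmul_eq1C (I : finType) (X Y : mx I I) :
  mxmul X Y = @idm R I -> mxmul Y X = @idm R I.
Proof.
move=> h; apply: (can_inj (@toMK I I)); rewrite toM_mul toM_1; apply: mulmx1C.
by rewrite -toM_mul h toM_1.
Qed.

Lemma unitary_adjr (I : finType) (U : mx I I) :
  unitary U -> mxmul U (adj U) = @idm R I.
Proof. exact: mxmul_eq1C. Qed.

Lemma unitary_adj (I : finType) (U : mx I I) : unitary U -> unitary (adj U).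
Proof. by move=> hU; rewrite /unitary adjK unitary_adjr. Qed.

Lemma unitaryM (I : finType) (U V : mx I I) :
  unitary U -> unitary V -> unitary (mxmul U V).
Proof.
move=> hU hV; rewrite /unitary adjM -mxmulA (mxmulA (adj U)) hU mxmul1l.
exact: hV.
Qed.

Definition rdiag (I : finType) (l : I -> R) : mx I I :=
  diagm (fun i => ((l i)%:C)%C).

Lemma adj_rdiag (I : finType) (l : I -> R) : adj (rdiag l) = rdiag l.
Proof.
apply: mxext => i j; rewrite /adj /rdiag /diagm conjM conjCn eq_sym.
by rewrite conj_real; case: eqP => [->|]; rewrite ?mul0r.
Qed.

Lemma hermitian_spectrum (I : finType) (X : mx I I) :
  adj X = X -> exists l : I -> R, spectrum X l.
Proof.
move=> hX; have hM : toM X \is hermsymmx.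
  apply/is_hermitianmxP; rewrite expr0 scale1r.
  by apply: (can_inj (@ofMK I I)); rewrite ofM_adj toMK hX.
have /orthomx_spectralP hs := hermitian_normalmx hM.
have hr := hermitian_spectral_diag_real hM.
have hu := spectral_unitarymx (toM X).
set P := spectralmx (toM X) in hs hu; set sp := spectral_diag (toM X) in hs hr.
exists (fun i => complex.Re (sp 0 (enum_rank i))), (ofM (P ^t*)); split.
  rewrite /unitary -ofM_adj -ofM_mul trmxCK -ofM_1; congr ofM.
  exact/unitarymxP.
rewrite -[LHS]toMK {1}hs invmx_unitary // !ofM_mul -ofM_adj trmxCK.
congr (mxmul (mxmul _ _) _); apply: mxext => i j.
rewrite /ofM /diagm !mxE (inj_eq enum_rank_inj) RRe_real.
  by case: eqP => [->|] /=; rewrite ?mul0r ?mul1r.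
by have /mxOverP := hr; apply.
Qed.

(** [Y] is read in two ways: as a factor of a positive operator on [I], and as a vector on [I * K].
    In the second reading [gram Y] is its reduced operator on [I] and [K] is the purifying
    system. *)
Definition gram (I K : finType) (Y : mx I K) : mx I I := mxmul Y (adj Y).

Lemma gramE (I K : finType) (Y : mx I K) i j : gram Y i j = \sum_k Y i k * (Y j k)^*.
Proof. by []. Qed.

Lemma gram_psd (I K : finType) (Y : mx I K) : psd (gram Y).
Proof.
move=> v; have -> : \sum_i \sum_j (v i)^* * gram Y i j * v j =
    \sum_k (\sum_i (v i)^* * Y i k) * (\sum_i (v i)^* * Y i k)^*.
  transitivity (\sum_i \sum_j \sum_k (v i)^* * Y i k * ((Y j k)^* * v j)).
    apply: eq_bigr => i _; apply: eq_bigr => j _; rewrite gramE mulr_sumr mulr_suml.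
    by apply: eq_bigr => k _; rewrite !mulrA.
  transitivity (\sum_i \sum_k \sum_j (v i)^* * Y i k * ((Y j k)^* * v j)).
    by apply: eq_bigr => i _; rewrite exchange_big.
  rewrite exchange_big; apply: eq_bigr => k _.
  rewrite mulr_suml; apply: eq_bigr => i _; rewrite conj_sum mulr_sumr.
  by apply: eq_bigr => j _; rewrite conjM conjCK [(Y j k)^* * _]mulrC.
by apply: sumr_ge0 => k _; exact: mul_conjC_ge0.
Qed.

(** Polarisation: the form is real at [e_j + c e_i]. The choices [c = 1] and [c = 'i] make
    [X j i + X i j] and ['i * (X j i - X i j)] real, and these two facts determine the conjugate of
    [X j i]. *)
Lemma psd_hermitian (I : finType) (X : mx I I) : psd X -> adj X = X.
Proof.
move=> hX.
pose v (c : C) (i j k : I) := (i == k)%:R + c * (j == k)%:R.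
have formv c i j : \sum_k \sum_l (v c i j k)^* * X k l * v c i j l =
   X i i + c * X i j + c^* * X j i + c^* * c * X j j.
  have row k : \sum_l (v c i j k)^* * X k l * v c i j l =
     (i == k)%:R * (X k i + c * X k j) + (j == k)%:R * (c^* * (X k i + c * X k j)).
    transitivity ((v c i j k)^* * (X k i + c * X k j)).
      under eq_bigr do rewrite -mulrA.
      rewrite -mulr_sumr; congr (_ * _); rewrite /v.
      under eq_bigr do rewrite mulrDr mulrCA (mulrC (X k _) (i == _)%:R) (mulrC (X k _)).
      by rewrite big_split /= -mulr_sumr !sum_deltal.
    by rewrite /v conjD conjM !conjCn mulrDl [c^* * _]mulrC !mulrA.
  under eq_bigr do rewrite row.
  rewrite big_split /= !sum_deltal mulrDr !mulrA !addrA.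
  by [].
have Hre c i j : (c * X i j + c^* * X j i) \is Num.real.
  have hii k : X k k \is Num.real.
    have := hX (v 0 k k); rewrite formv conjC0 !mul0r !addr0.
    exact: ger0_real.
  have := ger0_real (hX (v c i j)); rewrite formv.
  have hcc : c^* * c * X j j \is Num.real.
    by rewrite rpredM // mulrC ger0_real ?mul_conjC_ge0.
  rewrite rpredDr // -addrA rpredDl //.
apply: mxext => i j; rewrite /adj.
have h1 := Hre 1 j i; have h2 := Hre 'i j i.
move: h1 h2; rewrite conjC1 conjCi !mul1r !CrealE => /eqP h1 /eqP h2.
move: h1 h2; rewrite !conjD !conjM conjN conjCi opprK !mulNr => h1 h2.
have h3 : - (X j i)^* + (X i j)^* = X j i - X i j.
  apply: (mulfI (neq0Ci C)).
  by rewrite mulrDr mulrBr mulrN h2.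
have : 2 * (X j i)^* = 2 * X i j.
  have -> : 2 * (X j i)^* = ((X j i)^* + (X i j)^*) - (- (X j i)^* + (X i j)^*).
    by ring.
  by rewrite h1 h3; ring.
by apply: mulfI; rewrite pnatr_eq0.
Qed.

End MatrixAlgebra.

(** * Entropy and positive matrices *)

Section Entropy.
Variable R : realType.
Local Notation C := (R[i]).
Local Notation mx := (mx R).

Lemma real_sqr_sqrt (x : R) : 0 <= x ->
  (Num.sqrt x)%:C%C * (Num.sqrt x)%:C%C = x%:C%C :> C.
Proof.
by move=> x0; rewrite -(rmorphM (real_complex R)) /= -expr2 sqr_sqrtr.
Qed.

Lemma spectrum_psd_ge0 (I : finType) (X : mx I I) l :
  psd X -> spectrum X l -> forall i, 0 <= l i.
Proof.
move=> hX [U [hU eX]] i; rewrite -ler0c.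
have := hX (fun k => U k i).
suff -> : \sum_k \sum_j (U k i)^* * X k j * U j i = (l i)%:C%C by [].
transitivity (mxmul (mxmul (adj U) X) U i i).
  rewrite /mxmul /adj exchange_big; apply: eq_bigr => j _.
  by rewrite mulr_suml.
rewrite eX -!mxmulA (hU) mxmul1r mxmulA hU mxmul1l /diagm eqxx.
by rewrite mul1r.
Qed.

Lemma psd_spectrum (I : finType) (X : mx I I) :
  psd X -> exists l, spectrum X l /\ forall i, 0 <= l i.
Proof.
move=> hX; have [l hl] := hermitian_spectrum (psd_hermitian hX).
by exists l; split=> //; exact: spectrum_psd_ge0 hl.
Qed.

Lemma psd_gramP (I : finType) (X : mx I I) : psd X -> exists Y : mx I I, X = gram Y.
Proof.
move=> /psd_spectrum [l [[U [hU ->]] l0]].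
exists (fun i k => U i k * (Num.sqrt (l k))%:C%C).
apply: mxext => i j; rewrite gramE /mxmul; apply: eq_bigr => k _.
rewrite -/(mxmul U _ i k) mul_diagr /adj conjM conj_real -real_sqr_sqrt //.
by ring.
Qed.

Lemma gram_diag (I J : finType) (M : mx I J) i :
  gram M i i = (\sum_j nsq (M i j))%:C%C.
Proof. by rewrite gramE real_sum; apply: eq_bigr => j _; exact: mul_conj. Qed.

Lemma gram_adj_diag (I J : finType) (M : mx I J) j :
  mxmul (adj M) M j j = (\sum_i nsq (M i j))%:C%C.
Proof.
rewrite real_sum; apply: eq_bigr => i _; rewrite /adj mulrC; exact: mul_conj.
Qed.

Lemma unitary_row (I : finType) (U : mx I I) i :
  unitary U -> \sum_j nsq (U i j) = 1.
Proof.
move=> /unitary_adjr h; apply: (@complexI R); rewrite -gram_diag /gram h.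
by rewrite /idm eqxx.
Qed.

Lemma unitary_col (I : finType) (U : mx I I) j :
  unitary U -> \sum_i nsq (U i j) = 1.
Proof.
move=> h; apply: (@complexI R); rewrite -gram_adj_diag h.
by rewrite /idm eqxx.
Qed.

Lemma nsq_weight (z : C) (a b : R) (f : R -> R) :
  z * a%:C%C = z * b%:C%C -> nsq z * f a = nsq z * f b.
Proof.
have [->|z0] := eqVneq z 0; first by rewrite /nsq /= expr0n addr0 !mul0r.
by move=> /(mulfI z0) [->].
Qed.

(** The unitary [M = U^+ V] intertwines the two diagonal matrices, so a nonzero entry [M i j] forces
    [l i = l' j]. Its squared entries are doubly stochastic and carry one sum into the other. *)
Lemma spectrum_sum_uniq (I : finType) (X : mx I I) (l l' : I -> R) (f : R -> R) :
  spectrum X l -> spectrum X l' -> \sum_i f (l i) = \sum_i f (l' i).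
Proof.
move=> [U [hU eX]] [V [hV eX']]; pose M := mxmul (adj U) V.
have hM : unitary M by apply: unitaryM => //; exact: unitary_adj.
have e i j : M i j * (l i)%:C%C = M i j * (l' j)%:C%C.
  rewrite mulrC -[LHS](mul_diagl M (fun i => (l i)%:C%C)).
  rewrite -[RHS](mul_diagr M (fun i => (l' i)%:C%C)).
  rewrite /M; have -> : mxmul (diagm (fun i => (l i)%:C%C)) (mxmul (adj U) V) =
    mxmul (mxmul (adj U) X) V.
    by rewrite eX -!mxmulA (mxmulA (adj U) U) hU mxmul1l.
  by rewrite eX' -!mxmulA hV mxmul1r.
transitivity (\sum_i \sum_j nsq (M i j) * f (l i)).
  by apply: eq_bigr => i _; rewrite -mulr_suml unitary_row // mul1r.
rewrite exchange_big /=; apply: eq_bigr => j _.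
under eq_bigr do rewrite (nsq_weight f (e _ _)).
by rewrite -mulr_suml unitary_col // mul1r.
Qed.

(** Makes the choice by [epsilon] inside [entropy] harmless: any diagonalisation at hand may be
    used. *)
Lemma entropy_spectrum (I : finType) (X : mx I I) l :
  spectrum X l -> entropy X = \sum_i Defs.eta (l i).
Proof.
move=> hl; apply: (spectrum_sum_uniq (X := X)) => //.
by apply: ClassicalEpsilon.epsilon_spec; exists l.
Qed.

Lemma mtrace_spectrum (I : finType) (X : mx I I) l :
  spectrum X l -> mtrace X = (\sum_i l i)%:C%C.
Proof.
move=> [U [hU ->]]; rewrite mtrace_mulC mxmulA hU mxmul1l real_sum.
by apply: eq_bigr => i _; rewrite /diagm eqxx mul1r.
Qed.

Definition trm (I J : finType) (X : mx I J) : mx J I := fun j i => X i j.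
Definition cjm (I J : finType) (X : mx I J) : mx I J := fun i j => (X i j)^*.

Lemma cjmM (I J K : finType) (X : mx I J) (Y : mx J K) :
  cjm (mxmul X Y) = mxmul (cjm X) (cjm Y).
Proof.
by apply: mxext => i k; rewrite /cjm conj_sum; apply: eq_bigr => j _; rewrite conjM.
Qed.

Lemma cjmK (I J : finType) (X : mx I J) : cjm (cjm X) = X.
Proof. by apply: mxext => i k; rewrite /cjm conjCK. Qed.

Lemma adj_cjm (I J : finType) (X : mx I J) : adj (cjm X) = cjm (adj X).
Proof. by []. Qed.

Lemma cjm_unitary (I : finType) (U : mx I I) : unitary U -> unitary (cjm U).
Proof.
by move=> hU; rewrite /unitary adj_cjm -cjmM hU; apply: mxext => i j; rewrite /cjm /idm conjCn.
Qed.

Lemma gram_trm (I J : finType) (Y : mx I J) : gram (trm Y) = cjm (mxmul (adj Y) Y).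
Proof.
apply: mxext => i j; rewrite gramE /cjm conj_sum; apply: eq_bigr => k _.
by rewrite /adj conjM conjCK /trm.
Qed.

Lemma etaE (x : R) : Defs.eta x = x * - log2 x.
Proof. by rewrite /Defs.eta; case: ifP => [/eqP ->|_]; rewrite ?mul0r ?mulrN. Qed.

(* The singular values of Y, seen from either side: M = U^+ Y V intertwines
   the two spectra, and its squared entries have them as marginals. *)
Lemma entropy_gram_trm (I J : finType) (Y : mx I J) :
  entropy (gram Y) = entropy (gram (trm Y)).
Proof.
have [l [hl _]] := psd_spectrum (gram_psd Y).
have [l' [hl' _]] := psd_spectrum (gram_psd (trm Y)).
rewrite (entropy_spectrum hl) (entropy_spectrum hl').
move: hl hl' => [U [hU eY]] [V [hV eY']].
have hV' := cjm_unitary hV.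
pose M := mxmul (mxmul (adj U) Y) (cjm V).
have eMl : gram M = diagm (fun i => (l i)%:C%C).
  rewrite /gram /M !adjM adjK -!mxmulA (mxmulA (cjm V)) (unitary_adjr hV') mxmul1l.
  rewrite (mxmulA Y) -/(gram Y) eY -!mxmulA hU mxmul1r mxmulA hU mxmul1l.
  by [].
have eMr : mxmul (adj M) M = diagm (fun i => (l' i)%:C%C).
  rewrite /M !adjM adjK -!mxmulA (mxmulA U) (unitary_adjr hU) mxmul1l.
  rewrite (mxmulA (adj Y)) -[mxmul (adj Y) Y]cjmK -gram_trm eY' !cjmM -adj_cjm.
  rewrite -!mxmulA hV' mxmul1r mxmulA hV' mxmul1l.
  by apply: mxext => i j; rewrite /cjm /diagm conjM conjCn conj_real.
have e i j : M i j * (l i)%:C%C = M i j * (l' j)%:C%C.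
  rewrite mulrC -[LHS](mul_diagl M (fun i => (l i)%:C%C)) -eMl.
  by rewrite /gram -mxmulA eMr mul_diagr.
have sl i : l i = \sum_j nsq (M i j).
  by apply: (@complexI R); rewrite -gram_diag eMl /diagm eqxx mul1r.
have sl' j : l' j = \sum_i nsq (M i j).
  by apply: (@complexI R); rewrite -gram_adj_diag eMr /diagm eqxx mul1r.
transitivity (\sum_i \sum_j nsq (M i j) * - log2 (l i)).
  by apply: eq_bigr => i _; rewrite etaE {1}sl mulr_suml.
rewrite exchange_big /=; apply: eq_bigr => j _.
under eq_bigr do rewrite (nsq_weight (fun x => - log2 x) (e _ _)).
by rewrite etaE {2}sl' mulr_suml.
Qed.

(** The entropy of one side of a vector equals that of the other side, which is determined by
    [Y^+ Y]. An isometry on the first side leaves this product unchanged. *)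
Lemma entropy_gram_adj (I I' J : finType) (Y : mx I J) (Z : mx I' J) :
  mxmul (adj Y) Y = mxmul (adj Z) Z -> entropy (gram Y) = entropy (gram Z).
Proof. by move=> h; rewrite entropy_gram_trm gram_trm h -gram_trm -entropy_gram_trm. Qed.

Definition isometry (I J : finType) (W : mx J I) := mxmul (adj W) W = @idm R I.

Definition conjmx (I J : finType) (W : mx J I) (X : mx I I) : mx J J :=
  mxmul (mxmul W X) (adj W).

Lemma conjmx_gram (I J K : finType) (W : mx J I) (Y : mx I K) :
  conjmx W (gram Y) = gram (mxmul W Y).
Proof. by rewrite /conjmx /gram adjM !mxmulA. Qed.

Lemma psd_conjmx (I J : finType) (W : mx J I) (X : mx I I) : psd X -> psd (conjmx W X).
Proof. by move=> /psd_gramP[Y ->]; rewrite conjmx_gram; exact: gram_psd. Qed.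

Lemma entropy_isometry (I J : finType) (W : mx J I) (X : mx I I) :
  isometry W -> psd X -> entropy (conjmx W X) = entropy X.
Proof.
move=> hW /psd_gramP[Y ->]; rewrite conjmx_gram; apply: entropy_gram_adj.
by rewrite adjM -!mxmulA (mxmulA (adj W)) hW mxmul1l.
Qed.

Definition madd (I J : finType) (X Y : mx I J) : mx I J := fun i j => X i j + Y i j.
Definition rscale (I J : finType) (c : R) (X : mx I J) : mx I J := fun i j => c%:C%C * X i j.

Lemma psd_madd (I : finType) (X Y : mx I I) : psd X -> psd Y -> psd (madd X Y).
Proof.
move=> hX hY v; under eq_bigr do under eq_bigr do rewrite mulrDr mulrDl.
by under eq_bigr do rewrite big_split; rewrite big_split addr_ge0.
Qed.

Lemma psd_rscale (I : finType) (a : R) (X : mx I I) : 0 <= a -> psd X -> psd (rscale a X).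
Proof.
move=> a0 hX v; under eq_bigr do under eq_bigr do rewrite mulrCA -mulrA.
under eq_bigr do rewrite -mulr_sumr; rewrite -mulr_sumr mulr_ge0 ?ler0c //=; exact: hX.
Qed.

Lemma psd_ptr2 (I J : finType) (X : mx (I * J) (I * J)) : psd X -> psd (ptr2 X).
Proof.
move=> /psd_gramP[Y ->].
(* The traced index joins the columns: a discarded subsystem is handed to the purifying system. *)
suff -> : ptr2 (gram Y) = gram (fun i p => Y (i, p.1) p.2) by exact: gram_psd.
apply: mxext => i i'; rewrite gramE /ptr2 -(pair_big xpredT xpredT
  (fun j k => Y (i, j) k * (Y (i', j) k)^*)) /=.
by apply: eq_bigr => j _; rewrite gramE.
Qed.

Lemma psd_ptr1 (I J : finType) (X : mx (I * J) (I * J)) : psd X -> psd (ptr1 X).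
Proof.
move=> /psd_gramP[Y ->].
suff -> : ptr1 (gram Y) = gram (fun i p => Y (p.1, i) p.2) by exact: gram_psd.
apply: mxext => i i'; rewrite gramE /ptr1 -(pair_big xpredT xpredT
  (fun j k => Y (j, i) k * (Y (j, i') k)^*)) /=.
by apply: eq_bigr => j _; rewrite gramE.
Qed.

Lemma mtrace_ptr2 (I J : finType) (X : mx (I * J) (I * J)) : mtrace (ptr2 X) = mtrace X.
Proof. by rewrite /mtrace /ptr2 pair_bigA; apply: eq_bigr => -[]. Qed.

Lemma mtrace_ptr1 (I J : finType) (X : mx (I * J) (I * J)) : mtrace (ptr1 X) = mtrace X.
Proof. by rewrite /mtrace /ptr1 exchange_big pair_bigA; apply: eq_bigr => -[]. Qed.

Lemma reindex_isometry (I J : finType) (f : J -> I) : bijective f ->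
  isometry (fun j i => (f j == i)%:R).
Proof.
move=> bf; have := bf => -[g fK gK]; apply: mxext => i i'; rewrite /mxmul /adj /idm.
rewrite (bigD1 (g i)) //= big1 => [|j /negPf hj].
  by rewrite gK eqxx conjCn mul1r addr0.
case: eqP => [e|]; rewrite conjCn ?mul0r //.
by rewrite -e fK eqxx in hj.
Qed.

Lemma conjmx_reindex (I J : finType) (f : J -> I) (X : mx I I) :
  conjmx (fun j i => (f j == i)%:R) X = fun i j => X (f i) (f j).
Proof.
apply: mxext => i j; rewrite /conjmx /mxmul /adj.
under eq_bigr do rewrite sum_deltal conjCn eq_sym.
by rewrite sum_deltar.
Qed.

Lemma entropy_reindex (I J : finType) (f : J -> I) (X : mx I I) :
  bijective f -> psd X -> entropy (fun i j => X (f i) (f j)) = entropy X.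
Proof.
move=> bf hX; rewrite -conjmx_reindex entropy_isometry //.
exact: reindex_isometry.
Qed.

Lemma psd_reindex (I J : finType) (f : J -> I) (X : mx I I) :
  psd X -> psd (fun i j => X (f i) (f j)).
Proof. by move=> hX; rewrite -conjmx_reindex; exact: psd_conjmx. Qed.

(** A block-diagonal operator: [F] is a classical register that records which [X f] is present. *)
Definition flag (F I : finType) (X : F -> mx I I) : mx (I * F) (I * F) :=
  fun p q => (p.2 == q.2)%:R * X p.2 p.1 q.1.

Lemma flag_mul (F I : finType) (X Y : F -> mx I I) :
  mxmul (flag X) (flag Y) = flag (fun f => mxmul (X f) (Y f)).
Proof.
apply: mxext => -[i f] [j g]; rewrite /mxmul /flag /=.
rewrite -(pair_bigA _ (fun k h => (f == h)%:R * X f i k * ((h == g)%:R * Y h k j))) /=.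
rewrite mulr_sumr; apply: eq_bigr => k _.
under eq_bigr do rewrite -mulrA.
by rewrite sum_deltal mulrCA.
Qed.

Lemma flag_adj (F I : finType) (X : F -> mx I I) :
  adj (flag X) = flag (fun f => adj (X f)).
Proof.
apply: mxext => -[i f] [j g]; rewrite /adj /flag /= conjM conjCn eq_sym.
by case: eqP => [->|]; rewrite ?mul0r.
Qed.

Lemma flag_psd (F I : finType) (X : F -> mx I I) :
  (forall f, psd (X f)) -> psd (flag X).
Proof.
move=> h; have {}h f : exists Y : mx I I, X f = gram Y by apply: psd_gramP.
have [Y eY] := choice h.
suff -> : flag X = gram (flag Y) by exact: gram_psd.
by rewrite /gram flag_adj flag_mul; congr flag; apply/funext => f; exact: eY.
Qed.

(** The blocks are not normalised, so their traces already carry the probabilities and no separate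
    Shannon term appears. *)
Lemma entropy_flag (F I : finType) (X : F -> mx I I) :
  (forall f, psd (X f)) -> entropy (flag X) = \sum_f entropy (X f).
Proof.
move=> h.
have [l hl] : exists l : F -> I -> R, forall f, spectrum (X f) (l f).
  have /choice [l hl] : forall f, exists l : I -> R, spectrum (X f) l.
    by move=> f; have [l []] := psd_spectrum (h f); exists l.
  by exists l.
have [U hU] := choice hl.
rewrite (@entropy_spectrum _ _ (fun p => l p.2 p.1)).
  rewrite -(pair_bigA _ (fun i f => Defs.eta (l f i))) exchange_big /=.
  by apply: eq_bigr => f _; rewrite (entropy_spectrum (hl f)).
exists (flag U); split.
  rewrite /unitary flag_adj flag_mul; apply: mxext => -[i f] [j g].
  have [hu _] := hU f; rewrite /flag /= hu /idm xpair_eqE andbC.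
  by case: eqP; rewrite ?mul1r ?mul0r.
have -> : diagm (fun p => (l p.2 p.1)%:C%C) = flag (fun f => diagm (fun i => (l f i)%:C%C)).
  apply: mxext => -[i f] [j g]; rewrite /flag /diagm /= xpair_eqE.
  by case: (f == g); rewrite ?andbT ?andbF ?mul0r ?mul1r.
rewrite flag_adj !flag_mul; congr flag; apply/funext => f.
by have [_] := hU f.
Qed.

End Entropy.

(** * Integration of resolvents to the logarithm *)

Section LogIntegration.
Import numFieldNormedType.Exports.
Variable R : realType.

Lemma ler_add_small (a b c : R) : 0 <= c ->
  (forall s, 0 < s -> s < 1 -> a <= b + s * c) -> a <= b.
Proof.
move=> c0 h; apply/ler_addgt0Pr => e e0.
have c1 : 0 < 1 + c + e by lra.
have s0 : 0 < e / (1 + c + e) by rewrite divr_gt0.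
have s1 : e / (1 + c + e) < 1 by rewrite ltr_pdivrMr //; lra.
apply: le_trans (h _ s0 s1) _; rewrite lerD2l mulrAC ler_pdivrMr //.
by rewrite ler_wpM2l ?ltW //; lra.
Qed.

Lemma is_derive_bigsum (K : finType) (f : K -> R -> R) (d : K -> R) (x : R) :
  (forall k, is_derive x 1 (f k) (d k)) ->
  is_derive x 1 (fun t => \sum_k f k t) (\sum_k d k).
Proof.
move=> h; have -> : (fun t => \sum_k f k t) = \sum_k f k.
  by apply/funext => t; rewrite fct_sumE.
elim/big_ind2 : _ => [|f1 d1 f2 d2 h1 h2|k _]; last exact: h.
- exact: is_derive_cst.
- exact: is_deriveD.
Qed.

Section OneFamily.
Variables (K : finType) (w p q : K -> R).
Hypotheses (w0 : forall k, 0 <= w k) (p0 : forall k, 0 <= p k) (q0 : forall k, 0 <= q k).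

(** A primitive in [t] of the resolvent sum. Explicit bounds at both ends of the half-line take the
    place of limits. *)
Let G (t : R) := \sum_k w k * p k * ln (q k + t * p k).

Lemma log_sum_derive (t : R) : 0 < t ->
  is_derive t 1 G (\sum_k w k * (p k ^+ 2 / (q k + t * p k))).
Proof.
move=> t0; apply: is_derive_bigsum => k.
(* If [p k = 0] then [q k] may vanish too and the logarithm need not be differentiable there, but
   the prefactor makes the summand constant. *)
have [pk|pk] := eqVneq (p k) 0.
  have -> : (fun t0 => w k * p k * ln (q k + t0 * p k)) = cst 0.
    by apply/funext => s; rewrite pk mulr0 mul0r.
  by rewrite pk expr0n mul0r mulr0; exact: is_derive_cst.
have pk0 : 0 < p k by rewrite lt_def pk p0.
have s0 : 0 < q k + t * p k by rewrite ltr_wpDl // mulr_gt0.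
have h1 : is_derive t 1 (fun t => q k + t * p k) (p k).
  apply: is_derive_eq; rewrite add0r /GRing.scale /=; ring.
have h2 := is_derive1_ln s0.
have h3 : is_derive t 1 (fun t => ln (q k + t * p k)) _ := is_derive1_comp (f := @ln R) (g := fun t => q k + t * p k) h2 h1.
have h4 := is_deriveZ (w k * p k) h3.
by apply: (is_derive_eq h4); rewrite /GRing.scale /=; ring.
Qed.

(** Support condition: no logarithm of zero occurs at an index of nonzero weight. *)
Hypothesis supp : forall k, w k * p k != 0 -> 0 < q k.

Lemma log_sum_ge0 (t : R) : 0 < t -> \sum_k w k * p k * ln (q k) <= G t.
Proof.
move=> t0; apply: ler_sum => k _.
have [->|e] := eqVneq (w k * p k) 0; first by rewrite !mul0r.
have qk := supp e; rewrite ler_wpM2l ?mulr_ge0 // ler_ln ?posrE //.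
  by rewrite lerDl mulr_ge0 // ltW.
by rewrite ltr_wpDr // mulr_ge0 // ltW.
Qed.

(** Factoring out [q k] and using [ln (1 + x) <= x] leaves an error linear in [t]. *)
Lemma log_sum_le0 (t : R) : 0 < t ->
  G t <= \sum_k w k * p k * ln (q k) + t * \sum_k w k * (p k ^+ 2 / q k).
Proof.
move=> t0; rewrite mulr_sumr -big_split /=; apply: ler_sum => k _.
have [e|e] := eqVneq (w k * p k) 0.
  rewrite e !mul0r add0r !mulr_ge0 ?invr_ge0 ?sqr_ge0 //; exact: ltW.
have qk := supp e.
have -> : q k + t * p k = q k * (1 + t * p k / q k) by field; exact: lt0r_neq0.
have r0 : 0 <= t * p k / q k by rewrite divr_ge0 // mulr_ge0 // ltW.
rewrite lnM ?posrE //; last by rewrite ltr_wpDr.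
rewrite mulrDr lerD2l.
have -> : t * (w k * (p k ^+ 2 / q k)) = w k * p k * (t * p k / q k) by ring.
by rewrite ler_wpM2l ?mulr_ge0 // le_ln1Dx //; lra.
Qed.

Lemma log_sum_gey (t : R) : 0 < t ->
  (\sum_k w k * p k) * ln t + \sum_k w k * p k * ln (p k) <= G t.
Proof.
move=> t0; rewrite mulr_suml -big_split /=; apply: ler_sum => k _.
have [->|e] := eqVneq (w k * p k) 0; first by rewrite !mul0r addr0.
have pk0 : 0 < p k by rewrite lt_def p0 andbT; apply: contraNneq e => ->; rewrite mulr0.
rewrite -mulrDr ler_wpM2l ?mulr_ge0 // -lnM ?posrE // ler_ln ?posrE ?mulr_gt0 //.
  by rewrite lerDr.
by rewrite ltr_wpDl // mulr_gt0.
Qed.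

(** For large [t] the term [t * p k] dominates. Factoring it out leaves the total weight times
    [ln t], which is the same for two families of equal trace. *)
Lemma log_sum_ley (t : R) : 0 < t ->
  G t <= (\sum_k w k * p k) * ln t + \sum_k w k * p k * ln (p k) + t^-1 * \sum_k w k * q k.
Proof.
move=> t0; rewrite mulr_suml mulr_sumr -!big_split /=; apply: ler_sum => k _.
have [e|e] := eqVneq (w k * p k) 0.
  by rewrite e !mul0r !add0r !mulr_ge0 ?invr_ge0 // ltW.
have pk0 : 0 < p k by rewrite lt_def p0 andbT; apply: contraNneq e => ->; rewrite mulr0.
have tp : 0 < t * p k by rewrite mulr_gt0.
have -> : q k + t * p k = t * p k * (1 + q k / (t * p k)).
  by field; rewrite !lt0r_neq0.
have r0 : 0 <= q k / (t * p k) by rewrite divr_ge0 // ltW.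
rewrite lnM ?posrE //; last by rewrite ltr_wpDr.
rewrite lnM ?posrE // -!mulrDr !mulrDr -!addrA !lerD2l.
have -> : t^-1 * (w k * q k) = w k * p k * (q k / (t * p k)).
  by field; rewrite !lt0r_neq0.
by rewrite ler_wpM2l ?mulr_ge0 // le_ln1Dx //; lra.
Qed.

End OneFamily.

(* ln x is recovered from the resolvents 1/(q + t p) by integrating over t;
   monotonicity of the difference of the primitives, between t -> 0 and
   t -> oo, replaces the integral. *)
Lemma log_sum_mono (K K' : finType) (w p q : K -> R) (w' p' q' : K' -> R) :
  (forall k, 0 <= w k) -> (forall k, 0 <= p k) -> (forall k, 0 <= q k) ->
  (forall k, 0 <= w' k) -> (forall k, 0 <= p' k) -> (forall k, 0 <= q' k) ->
  (forall k, w k * p k != 0 -> 0 < q k) ->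
  (forall k, w' k * p' k != 0 -> 0 < q' k) ->
  \sum_k w k * p k = \sum_k w' k * p' k ->
  (forall t, 0 < t -> \sum_k w' k * (p' k ^+ 2 / (q' k + t * p' k)) <=
                      \sum_k w k * (p k ^+ 2 / (q k + t * p k))) ->
  \sum_k w' k * p' k * (ln (p' k) - ln (q' k)) <=
  \sum_k w k * p k * (ln (p k) - ln (q k)).
Proof.
move=> w0 p0 q0 w0' p0' q0' sp sp' etr hF.
pose D t := \sum_k w k * p k * ln (q k + t * p k) -
            \sum_k w' k * p' k * ln (q' k + t * p' k).
have dD (t : R) : 0 < t -> is_derive t 1 D (\sum_k w k * (p k ^+ 2 / (q k + t * p k)) -
    \sum_k w' k * (p' k ^+ 2 / (q' k + t * p' k))).
  by move=> t0; apply: is_deriveB; apply: log_sum_derive.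
have mono (s t : R) : 0 < s -> s < t -> D s <= D t.
  move=> s0 st; apply: (@ger0_derive1_ndecr R D s t) => //; last exact: ltW.
  - move=> x; rewrite in_itv /= => /andP[sx _].
    by have [] := dD x (lt_trans s0 sx).
  - move=> x; rewrite in_itv /= => /andP[sx _].
    have x0 := lt_trans s0 sx.
    by rewrite derive1E; have [_ ->] := dD x x0; rewrite subr_ge0 hF.
  - apply: derivable_within_continuous => x; rewrite in_itv /= => /andP[sx _].
    by have [] := dD x (lt_le_trans s0 sx).
set C1 := \sum_k w' k * (p' k ^+ 2 / q' k).
set C2 := \sum_k w k * q k.
have C1_0 : 0 <= C1.
  by apply: sumr_ge0 => k _; rewrite !mulr_ge0 ?sqr_ge0 ?invr_ge0.
have C2_0 : 0 <= C2 by apply: sumr_ge0 => k _; rewrite mulr_ge0.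
have split_ (J : finType) (a b c : J -> R) : \sum_k a k * (b k - c k) =
    \sum_k a k * b k - \sum_k a k * c k.
  by rewrite -sumrB; apply: eq_bigr => k _; rewrite mulrBr.
rewrite !split_.
(* [D] is compared at [s] and at [s^-1]: the bounds near zero and near infinity then have errors
   [s * C1] and [s * C2], and the terms in [ln s^-1] cancel by [etr]. *)
apply: (@ler_add_small _ _ (C1 + C2)) => [|s s0 s1]; first exact: addr_ge0.
have t0 : 0 < s^-1 by rewrite invr_gt0.
have st : s < s^-1.
  by rewrite (lt_trans s1) // invf_gt1.
have := mono _ _ s0 st; rewrite /D.
have h1 := log_sum_ge0 w0 p0 sp s0.
have h2 := log_sum_le0 w0' p0' q0' sp' s0.
have h3 := log_sum_ley w0 p0 q0 t0.
have h4 := log_sum_gey w0' p0' q0' t0.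
rewrite invrK etr in h3.
rewrite -/C1 in h2; rewrite -/C2 in h3; rewrite mulrDr; lra.
Qed.

End LogIntegration.

(** * Strong subadditivity *)

Section SSA.
Variable R : realType.
Local Notation C := (R[i]).
Local Notation mx := (mx R).

Definition variational (I : finType) (t : R) (rho sg X : mx I I) : R :=
  2 * complex.Re (mtrace (mxmul (adj X) rho))
  - complex.Re (mtrace (mxmul (mxmul X (adj X)) sg))
  - t * complex.Re (mtrace (mxmul (mxmul (adj X) X) rho)).

Section Spectral.
Variables (I : finType) (U V : mx I I) (p q : I -> R).
Hypotheses (hU : unitary U) (hV : unitary V).
Let rho : mx I I := mxmul (mxmul U (diagm (fun i => (p i)%:C%C))) (adj U).
Let sg : mx I I := mxmul (mxmul V (diagm (fun i => (q i)%:C%C))) (adj V).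
Let c : mx I I := mxmul (adj V) U.

(** In the coordinates [Y = V^+ X U] the functional splits into independent scalar quadratics, one
    for each pair of eigenvectors. *)
Lemma variational_spectral (t : R) (Y : mx I I) :
  variational t rho sg (mxmul (mxmul V Y) (adj U)) =
  \sum_(k : I * I) (2 * p k.2 * complex.Re ((Y k.1 k.2)^* * c k.1 k.2)
                    - (q k.1 + t * p k.2) * nsq (Y k.1 k.2)).
Proof.
set X := mxmul (mxmul V Y) (adj U).
have aX : adj X = mxmul U (mxmul (adj Y) (adj V)) by rewrite /X !adjM adjK.
have e1 : mtrace (mxmul (adj X) rho) =
    \sum_(k : I * I) (p k.2)%:C%C * ((Y k.1 k.2)^* * c k.1 k.2).
  rewrite aX /rho -!mxmulA mtrace_mulC -!mxmulA hU mxmul1r.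
  rewrite (mxmulA (adj V)) -/c /mtrace exchange_big /=.
  rewrite -(pair_bigA _ (fun j i => (p i)%:C%C * ((Y j i)^* * c j i))) /=.
  apply: eq_bigr => j _; apply: eq_bigr => i _; rewrite mul_diagr /adj.
  by ring.
have e2 : mtrace (mxmul (mxmul X (adj X)) sg) =
    \sum_(k : I * I) (q k.1 * nsq (Y k.1 k.2))%:C%C.
  rewrite aX /sg /X -!mxmulA mtrace_mulC -!mxmulA hV mxmul1r.
  rewrite (mxmulA (adj U) U) hU mxmul1l (mxmulA (adj V) V) hV mxmul1l mxmulA.
  rewrite -(pair_bigA _ (fun j i => (q j * nsq (Y j i))%:C%C)) /=.
  apply: eq_bigr => j _; rewrite mul_diagr -/(gram Y) gram_diag -real_sum.
  by rewrite -mulr_sumr mulrC (rmorphM (real_complex R)).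
have e3 : mtrace (mxmul (mxmul (adj X) X) rho) =
    \sum_(k : I * I) (p k.2 * nsq (Y k.1 k.2))%:C%C.
  rewrite aX /rho /X -!mxmulA mtrace_mulC -!mxmulA hU mxmul1r.
  rewrite (mxmulA (adj U) U) hU mxmul1l (mxmulA (adj V) V) hV mxmul1l mxmulA.
  rewrite -(pair_bigA _ (fun j i => (p i * nsq (Y j i))%:C%C)) exchange_big /=.
  apply: eq_bigr => i _; rewrite mul_diagr gram_adj_diag -real_sum.
  by rewrite -mulr_sumr mulrC (rmorphM (real_complex R)).
rewrite /variational e1 e2 e3 !Re_sum !mulr_sumr -!sumrB; apply: eq_bigr => k _.
rewrite ReZ /=; ring.
Qed.

(** Completing the square in [z]. At [b = 0] the quotient is zero by convention, which is the right
    value because [a = 0] there. *)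
Lemma quad_le (z x : C) (a b : R) : 0 <= a -> 0 <= b -> (b = 0 -> a = 0) ->
  2 * a * complex.Re (z^* * x) - b * nsq z <= nsq x * (a ^+ 2 / b).
Proof.
move=> a0 b0 hb; have [eb|nb] := eqVneq b 0.
  by rewrite eb (hb eb) invr0 !(mul0r, mulr0) subr0.
have {}b0 : 0 < b by rewrite lt_def nb.
case: z x => u v [x y]; rewrite /nsq /= mulrA ler_pdivlMr // -subr_ge0.
have -> : (x ^+ 2 + y ^+ 2) * a ^+ 2 - (2 * a * (u * x - - v * y) - b * (u ^+ 2 + v ^+ 2)) * b
  = (a * x - b * u) ^+ 2 + (a * y - b * v) ^+ 2 by ring.
by rewrite addr_ge0 ?sqr_ge0.
Qed.

Lemma quad_eq (x : C) (a b : R) : (b = 0 -> a = 0) ->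
  2 * a * complex.Re (((a / b)%:C%C * x)^* * x) - b * nsq ((a / b)%:C%C * x)
    = nsq x * (a ^+ 2 / b).
Proof.
move=> hb; have [eb|nb] := eqVneq b 0.
  by rewrite eb (hb eb) invr0 !(mul0r, mulr0) subr0.
by case: x => u v; rewrite /nsq /=; field.
Qed.

Hypotheses (p0 : forall i, 0 <= p i) (q0 : forall i, 0 <= q i).

Lemma variational_le (t : R) (X : mx I I) : 0 < t -> variational t rho sg X <=
  \sum_(k : I * I) nsq (c k.1 k.2) * (p k.2 ^+ 2 / (q k.1 + t * p k.2)).
Proof.
move=> t0; pose Y := mxmul (mxmul (adj V) X) U.
have -> : X = mxmul (mxmul V Y) (adj U).
  by rewrite /Y !mxmulA (unitary_adjr hV) mxmul1l -mxmulA (unitary_adjr hU) mxmul1r.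
rewrite variational_spectral; apply: ler_sum => k _; apply: quad_le => //.
  by rewrite addr_ge0 // mulr_ge0 // ltW.
have := p0 k.2; have := q0 k.1; nra.
Qed.

Lemma variational_max (t : R) : 0 < t -> exists X, variational t rho sg X =
  \sum_(k : I * I) nsq (c k.1 k.2) * (p k.2 ^+ 2 / (q k.1 + t * p k.2)).
Proof.
(* The stationary point of each scalar quadratic, carried back from the eigenbases. *)
move=> t0; exists (mxmul (mxmul V (fun j i => (p i / (q j + t * p i))%:C%C * c j i)) (adj U)).
rewrite variational_spectral; apply: eq_bigr => k _; apply: quad_eq.
have := p0 k.2; have := q0 k.1; nra.
Qed.

End Spectral.

Lemma kron_mul (I J K I' J' K' : finType) (A : mx I J) (B : mx I' J')
    (A' : mx J K) (B' : mx J' K') :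
  mxmul (kron A B) (kron A' B') = kron (mxmul A A') (mxmul B B').
Proof.
apply: mxext => -[i i'] [k k']; rewrite /kron /mxmul sum_pair /= mulr_suml.
apply: eq_bigr => j _; rewrite mulr_sumr; apply: eq_bigr => j' _.
by rewrite mulrACA.
Qed.

Lemma kron_adj (I J I' J' : finType) (A : mx I J) (B : mx I' J') :
  adj (kron A B) = kron (adj A) (adj B).
Proof. by apply: mxext => p q; rewrite /adj /kron conjM. Qed.

Lemma kron_idm (I J : finType) : kron (@idm R I) (@idm R J) = @idm R (I * J)%type.
Proof.
by apply: mxext => -[i j] [i' j']; rewrite /kron /idm /= xpair_eqE -mulnb natrM.
Qed.

Lemma unitary_tens (Q Z : finType) (V : mx Z Z) :
  unitary V -> unitary (kron (@idm R Q) V).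
Proof.
move=> hV; by rewrite /unitary kron_adj kron_mul adj_idm mxmul1l hV kron_idm.
Qed.

Definition idm_ptr1 (Q Z : finType) (rho : mx (Q * Z) (Q * Z)) : mx (Q * Z) (Q * Z) :=
  kron (@idm R Q) (ptr1 rho).

Definition centropy (Q Z : finType) (rho : mx (Q * Z) (Q * Z)) : R :=
  entropy rho - entropy (ptr1 rho).

Lemma ln2_gt0 : 0 < ln 2 :> R.
Proof. by rewrite ln_gt0 // ltr1n. Qed.

Lemma ln2_eta (x : R) : ln 2 * Defs.eta x = - (x * ln x).
Proof. by rewrite etaE /log2; field; apply: lt0r_neq0; exact: ln2_gt0. Qed.

Section RelativeEntropy.
Variables (Q Z : finType) (rho : mx (Q * Z) (Q * Z)).
Hypothesis hrho : psd rho.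

(* The last sum is the relative entropy of rho with respect to 1 (x) rho_Z, read
   off the eigenbases of the two operators. *)
Lemma centropy_relent : exists (U : mx (Q * Z) (Q * Z)) (V0 : mx Z Z) (p : Q * Z -> R) (q0 : Z -> R),
  let V := kron (@idm R Q) V0 in
  let w k := nsq (mxmul (adj V) U k.1 k.2) in
  [/\ unitary U /\ unitary V,
      rho = mxmul (mxmul U (diagm (fun i => (p i)%:C%C))) (adj U),
      idm_ptr1 rho = mxmul (mxmul V (diagm (fun i => (q0 i.2)%:C%C))) (adj V),
      (forall i, 0 <= p i) /\ (forall i, 0 <= q0 i) &
     [/\ forall k, w k * p k.2 != 0 -> 0 < q0 k.1.2,
         (\sum_k w k * p k.2)%:C%C = mtrace rho &
         \sum_k w k * p k.2 * (ln (p k.2) - ln (q0 k.1.2)) = - (ln 2 * centropy rho)]].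
Proof.
have [p [hp p0]] := psd_spectrum hrho.
have [q0 [hq q00]] := psd_spectrum (psd_ptr1 hrho).
have eS := entropy_spectrum hp; have eS0 := entropy_spectrum hq.
have etr := mtrace_spectrum hp.
move: hp hq => [U [hU eU]] [V0 [hV0 eV0]].
have hV := unitary_tens Q hV0.
exists U, V0, p, q0 => V w.
pose c := mxmul (adj V) U.
have hc : unitary c by apply: unitaryM => //; exact: unitary_adj.
have wi i : \sum_j nsq (c j i) = 1 by exact: unitary_col.
(* Both sides are the diagonal entry at [z] of the marginal on [Z], written in its own
   eigenbasis. *)
have wq z : \sum_k \sum_i nsq (c (k, z) i) * p i = q0 z.
  apply: (@complexI R).
  transitivity (mxmul (mxmul (adj V0) (ptr1 rho)) V0 z z); last first.
    rewrite eV0 -!mxmulA hV0 mxmul1r mxmulA hV0 mxmul1l /diagm eqxx mul1r //.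
  have e k : (\sum_i nsq (c (k, z) i) * p i)%:C%C =
      mxmul (mxmul (adj V) rho) V (k, z) (k, z).
    have -> : mxmul (mxmul (adj V) rho) V = mxmul (mxmul c (diagm (fun i => (p i)%:C%C))) (adj c).
      by rewrite /c adjM adjK eU !mxmulA.
    rewrite real_sum; apply: eq_bigr => i _; rewrite -/(mxmul c _ _ i) mul_diagr.
    by rewrite /adj (rmorphM (real_complex R)) /= -mul_conj mulrAC.
  rewrite real_sum; under eq_bigr do rewrite e.
  transitivity (\sum_k \sum_y (\sum_x (V0 x z)^* * rho (k, x) (k, y)) * V0 y z).
    apply: eq_bigr => k _; rewrite /mxmul sum_pair.
    rewrite -[RHS](sum_deltar (fun k' => \sum_y (\sum_x (V0 x z)^* * rho (k, x) (k', y)) * V0 y z)).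
    apply: eq_bigr => k' _; rewrite mulr_suml; apply: eq_bigr => y _.
    rewrite /V /kron /idm /= mulrA mulrAC; congr (_ * _ * _).
    rewrite sum_pair -[RHS](sum_deltar (fun k1 => \sum_x (V0 x z)^* * rho (k1, x) (k', y))).
    apply: eq_bigr => k1 _; rewrite mulr_suml; apply: eq_bigr => x _.
    by rewrite /adj /= conjM conjCn; ring.
  rewrite exchange_big; apply: eq_bigr => y _; rewrite -mulr_suml; congr (_ * _).
  rewrite exchange_big; apply: eq_bigr => x _ /=; rewrite -mulr_sumr.
  by [].
have swp (g : Z -> R) : \sum_k w k * p k.2 * g k.1.2 = \sum_z q0 z * g z.
  rewrite -(pair_bigA _ (fun j i => nsq (c j i) * p i * g j.2)) /=.
  rewrite -(pair_bigA _ (fun k z => \sum_i nsq (c (k, z) i) * p i * g z)) /=.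
  rewrite exchange_big; apply: eq_bigr => z _; rewrite -wq mulr_suml.
  by apply: eq_bigr => k _; rewrite mulr_suml.
have swi (g : Q * Z -> R) : \sum_k w k * g k.2 = \sum_i g i.
  rewrite -(pair_bigA _ (fun j i => nsq (c j i) * g i)) exchange_big /=.
  by apply: eq_bigr => i _; rewrite -mulr_suml wi mul1r.
split=> //.
- rewrite /idm_ptr1 eV0 /V kron_adj adj_idm.
  have -> : diagm (fun i : Q * Z => (q0 i.2)%:C%C) = kron (@idm R Q) (diagm (fun z => (q0 z)%:C%C)).
    by apply: mxext => -[i j] [i' j']; rewrite /diagm /kron /idm /= xpair_eqE -mulnb natrM mulrA.
  by rewrite !kron_mul !mxmul1l.
- split.
  (* A nonzero weight is one of the nonnegative terms that sum to [q0 z]. *)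
  + move=> [[k z] i] /= h; rewrite -wq (bigD1 k) //= (bigD1 i) //=.
    rewrite -addrA ltr_wpDr //.
      rewrite addr_ge0 ?sumr_ge0 // => j _; first by rewrite mulr_ge0 ?nsq_ge0.
      by rewrite sumr_ge0 // => l _; rewrite mulr_ge0 ?nsq_ge0.
    by rewrite lt_def h mulr_ge0 ?nsq_ge0.
  + by rewrite etr swi.
  + have -> : \sum_k w k * p k.2 * (ln (p k.2) - ln (q0 k.1.2)) =
        \sum_k w k * (p k.2 * ln (p k.2)) - \sum_k w k * p k.2 * ln (q0 k.1.2).
      by rewrite -sumrB; apply: eq_bigr => k _; ring.
    rewrite (swi (fun i => p i * ln (p i))) (swp (fun z => ln (q0 z))).
    rewrite /centropy eS eS0 mulrBr !mulr_sumr opprB -!sumrN.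
    rewrite addrC; congr (_ + _); apply: eq_bigr => i _; rewrite ln2_eta ?opprK //.
Qed.

End RelativeEntropy.

Definition ptr_last (Q X Y : finType) (rho : mx (Q * (X * Y)) (Q * (X * Y))) : mx (Q * X) (Q * X) :=
  fun a b => \sum_y rho (a.1, (a.2, y)) (b.1, (b.2, y)).

Definition lift_op (Q X Y : finType) (A : mx (Q * X) (Q * X)) : mx (Q * (X * Y)) (Q * (X * Y)) :=
  fun a b => (a.2.2 == b.2.2)%:R * A (a.1, a.2.1) (b.1, b.2.1).

Lemma adj_lift_op (Q X Y : finType) (A : mx (Q * X) (Q * X)) :
  adj (@lift_op Q X Y A) = lift_op (adj A).
Proof. by apply: mxext => a b; rewrite /adj /lift_op conjM conjCn eq_sym. Qed.

Lemma sum_triple (Q X Y : finType) (F : Q * (X * Y) -> C) :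
  \sum_a F a = \sum_(a : Q * X) \sum_y F (a.1, (a.2, y)).
Proof.
rewrite !sum_pair; apply: eq_bigr => q _ /=; rewrite sum_pair.
by [].
Qed.

Lemma lift_op_mul (Q X Y : finType) (A B : mx (Q * X) (Q * X)) :
  mxmul (@lift_op Q X Y A) (lift_op B) = lift_op (mxmul A B).
Proof.
apply: mxext => a b; rewrite /mxmul /lift_op sum_triple /= mulr_sumr.
apply: eq_bigr => -[q x] _ /=.
under eq_bigr do rewrite -mulrA.
by rewrite sum_deltal mulrCA.
Qed.

Lemma mtrace_lift_op (Q X Y : finType) (A : mx (Q * X) (Q * X)) (rho : mx (Q * (X * Y)) (Q * (X * Y))) :
  mtrace (mxmul (lift_op A) rho) = mtrace (mxmul A (ptr_last rho)).
Proof.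
rewrite /mtrace /mxmul sum_triple; apply: eq_bigr => a _.
under eq_bigr do rewrite sum_triple; rewrite exchange_big; apply: eq_bigr => b _ /=.
rewrite /ptr_last mulr_sumr; apply: eq_bigr => y _; rewrite /lift_op /=.
under eq_bigr do rewrite -mulrA.
by rewrite sum_deltal -!surjective_pairing.
Qed.

(** Tensoring with the identity is dual to [ptr_last] under the trace, so each competitor for the
    reduced operators yields one of equal value for the full operators. *)
Lemma variational_lift_op (Q X Y : finType) t (A : mx (Q * X) (Q * X)) (rho sg : mx (Q * (X * Y)) (Q * (X * Y))) :
  variational t (ptr_last rho) (ptr_last sg) A = variational t rho sg (lift_op A).
Proof. by rewrite /variational adj_lift_op !lift_op_mul !mtrace_lift_op. Qed.

Lemma ptr_last_idm_ptr1 (Q X Y : finType) (rho : mx (Q * (X * Y)) (Q * (X * Y))) :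
  ptr_last (idm_ptr1 rho) = idm_ptr1 (ptr_last rho).
Proof.
apply: mxext => -[k x] [k' x']; rewrite /ptr_last /idm_ptr1 /kron /ptr1 /= -mulr_sumr.
by rewrite exchange_big.
Qed.

Lemma psd_ptr_last (Q X Y : finType) (rho : mx (Q * (X * Y)) (Q * (X * Y))) :
  psd rho -> psd (ptr_last rho).
Proof.
move=> h; apply: (@psd_ptr2 _ _ Y (fun a b => rho (a.1.1, (a.1.2, a.2)) (b.1.1, (b.1.2, b.2)))).
exact: (@psd_reindex _ _ _ (fun a : (Q * X) * Y => (a.1.1, (a.1.2, a.2)))).
Qed.

Lemma mtrace_ptr_last (Q X Y : finType) (rho : mx (Q * (X * Y)) (Q * (X * Y))) :
  mtrace (ptr_last rho) = mtrace rho.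
Proof. by rewrite /mtrace sum_triple. Qed.

Theorem strong_subadditivity (Q X Y : finType) (rho : mx (Q * (X * Y)) (Q * (X * Y))) :
  psd rho -> centropy rho <= centropy (ptr_last rho).
Proof.
move=> h; have h' := psd_ptr_last h.
have [U [V [p [q [[hU hV] e1 e2 [p0 q0] [sp tr val]]]]]] := centropy_relent h.
have [U' [V' [p' [q' [[hU' hV'] e1' e2' [p0' q0'] [sp' tr' val']]]]]] := centropy_relent h'.
(* Conditional entropy is minus a relative entropy over [ln 2], so the inequality reverses. *)
rewrite -(ler_pM2l ln2_gt0) -lerN2 -val -val'.
apply: (log_sum_mono (w := fun k => nsq (mxmul (adj (kron (@idm R Q) V)) U k.1 k.2))
  (p := fun k => p k.2) (q := fun k => q k.1.2)
  (w' := fun k => nsq (mxmul (adj (kron (@idm R Q) V')) U' k.1 k.2))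
  (p' := fun k => p' k.2) (q' := fun k => q' k.1.2)) => //; try by move=> k; exact: nsq_ge0.
  by apply: (@complexI R); rewrite tr tr' mtrace_ptr_last.
move=> t t0.
(* [A] is optimal for the reduced pair, while its lift is only one competitor for the full pair. *)
have [A <-] := variational_max (p := p') (q := fun i => q' i.2) hU' hV' p0' (fun i => q0' i.2) t0.
rewrite -e1' -e2' -ptr_last_idm_ptr1 variational_lift_op {1}e1 e2.
exact: (variational_le (p := p) (q := fun i => q i.2) hU hV p0 (fun i => q0 i.2)).
Qed.

End SSA.

(** * Conditional entropy *)

Section ConditionalEntropy.
Variable R : realType.
Local Notation C := (R[i]).
Local Notation mx := (mx R).

Definition rtr (I : finType) (X : mx I I) : R := complex.Re (mtrace X).

Lemma rtr_spectrum (I : finType) (X : mx I I) l : spectrum X l -> rtr X = \sum_i l i.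
Proof. by move=> h; rewrite /rtr (mtrace_spectrum h). Qed.

Lemma rtr_ge0 (I : finType) (X : mx I I) : psd X -> 0 <= rtr X.
Proof. by move=> /psd_spectrum[l [/rtr_spectrum -> l0]]; exact: sumr_ge0. Qed.

Lemma rtr_madd (I : finType) (X Y : mx I I) : rtr (madd X Y) = rtr X + rtr Y.
Proof. by rewrite /rtr -ReD /mtrace /madd -big_split. Qed.

Lemma rtr_ptr1 (I J : finType) (X : mx (I * J) (I * J)) : rtr (ptr1 X) = rtr X.
Proof. by rewrite /rtr mtrace_ptr1. Qed.

Lemma rtr_ptr2 (I J : finType) (X : mx (I * J) (I * J)) : rtr (ptr2 X) = rtr X.
Proof. by rewrite /rtr mtrace_ptr2. Qed.

Lemma ptr1_madd (I J : finType) (X Y : mx (I * J) (I * J)) :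
  ptr1 (madd X Y) = madd (ptr1 X) (ptr1 Y).
Proof. by apply: mxext => j j'; rewrite /ptr1 /madd big_split. Qed.

Lemma eta0 : Defs.eta 0 = 0 :> R. Proof. by rewrite etaE mul0r. Qed.
Lemma eta1 : Defs.eta 1 = 0 :> R. Proof. by rewrite etaE /log2 ln1 mul0r oppr0 mulr0. Qed.

Lemma entropy_unit (X : mx unit unit) : psd X -> entropy X = Defs.eta (rtr X).
Proof.
move=> /psd_spectrum [l [hl _]]; rewrite (entropy_spectrum hl) (rtr_spectrum hl).
by rewrite !(big_pred1 tt) //; case.
Qed.

(** Gibbs' inequality against the uniform spectrum [t / d], with [eta (rtr X)] accounting for the
    missing normalisation. *)
Lemma entropy_le_log (I : finType) (X : mx I I) :
  psd X -> entropy X <= rtr X * log2 #|I|%:R + Defs.eta (rtr X).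
Proof.
move=> /psd_spectrum [l [hl l0]]; rewrite (entropy_spectrum hl) (rtr_spectrum hl).
set t := \sum_i l i; have t0 : 0 <= t by exact: sumr_ge0.
have [te|tn] := eqVneq t 0.
  have z i : l i = 0 by apply: (psumr_eq0P (fun i _ => l0 i) te).
  by rewrite te mul0r add0r eta0 big1 // => i _; rewrite z eta0.
have {}t0 : 0 < t by rewrite lt_def tn.
have d0 : 0 < #|I|%:R :> R.
  rewrite ltr0n lt0n; apply: contraNneq tn => /card0_eq I0.
  by rewrite /t big_pred0.
set d := #|I|%:R in d0 *.
rewrite -(ler_pM2l (ln2_gt0 R)) mulr_sumr mulrDr ln2_eta /log2.
have -> : ln 2 * (t * (ln d / ln 2)) = t * ln d by field; apply: lt0r_neq0; exact: ln2_gt0.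
(* The inserted terms [t / d - l i] sum to zero; with them the comparison holds term by term through
   [ln x <= x - 1]. *)
have -> : t * ln d - t * ln t = \sum_i (t / d - l i + l i * ln (d / t)).
  rewrite big_split sumrB /= sumr_const -mulr_suml -/t -mulr_natr -/d ln_div ?posrE //.
  by field; exact: lt0r_neq0.
apply: ler_sum => i _; rewrite ln2_eta.
have [->|n] := eqVneq (l i) 0.
  by rewrite !mul0r oppr0 !addr0 divr_ge0 // ltW.
have li : 0 < l i by rewrite lt_def n l0.
have r0 : 0 < t / d / l i by rewrite !divr_gt0.
have h : ln (t / d / l i) <= t / d / l i - 1.
  have {1}-> : t / d / l i = 1 + (t / d / l i - 1) by rewrite addrC subrK.
  by rewrite le_ln1Dx //; lra.
have : l i * ln (t / d / l i) <= l i * (t / d / l i - 1) by rewrite ler_pM2l.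
have -> : l i * (t / d / l i - 1) = t / d - l i by field; rewrite n lt0r_neq0.
rewrite !ln_div ?posrE ?divr_gt0 //; lra.
Qed.

Lemma isometry_tens (Q X Y : finType) (W : mx Y X) :
  isometry W -> isometry (kron (@idm R Q) W).
Proof. by move=> hW; rewrite /isometry kron_adj kron_mul adj_idm mxmul1l hW kron_idm. Qed.

Definition conj_right (Q X Y : finType) (W : mx Y X) (rho : mx (Q * X) (Q * X)) :
  mx (Q * Y) (Q * Y) := conjmx (kron (@idm R Q) W) rho.

Lemma conj_rightE (Q X Y : finType) (W : mx Y X) (rho : mx (Q * X) (Q * X)) a b :
  conj_right W rho a b = \sum_x' (\sum_x W a.2 x * rho (a.1, x) (b.1, x')) * (W b.2 x')^*.
Proof.
rewrite /conj_right /conjmx kron_adj adj_idm /mxmul sum_pair.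
rewrite -[RHS](sum_deltar (fun k' => \sum_x' (\sum_x W a.2 x * rho (a.1, x) (k', x')) * (W b.2 x')^*)).
apply: eq_bigr => k' _; rewrite mulr_suml; apply: eq_bigr => x' _.
rewrite {2}/kron /adj /= /idm [_%:R * _]mulrC mulrA; congr (_ * _ * _).
rewrite sum_pair -[RHS](sum_deltal (fun k => \sum_x W a.2 x * rho (k, x) (k', x'))).
apply: eq_bigr => k _; rewrite mulr_sumr; apply: eq_bigr => x _.
by rewrite /kron /idm /= mulrA.
Qed.

Lemma ptr1_conj_right (Q X Y : finType) (W : mx Y X) (rho : mx (Q * X) (Q * X)) :
  ptr1 (conj_right W rho) = conjmx W (ptr1 rho).
Proof.
apply: mxext => y y'; rewrite /ptr1; under eq_bigr do rewrite conj_rightE /=.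
rewrite exchange_big; apply: eq_bigr => x' _; rewrite -mulr_suml; congr (_ * _).
by rewrite exchange_big; apply: eq_bigr => x _; rewrite -mulr_sumr.
Qed.

Lemma psd_conj_right (Q X Y : finType) (W : mx Y X) (rho : mx (Q * X) (Q * X)) :
  psd rho -> psd (conj_right W rho).
Proof. exact: psd_conjmx. Qed.

Lemma centropy_conj_right (Q X Y : finType) (W : mx Y X) (rho : mx (Q * X) (Q * X)) :
  isometry W -> psd rho -> centropy (conj_right W rho) = centropy rho.
Proof.
move=> hW h; rewrite /centropy ptr1_conj_right !entropy_isometry //; first exact: isometry_tens.
exact: psd_ptr1.
Qed.

(** Strong subadditivity with a one-dimensional system kept and [X] discarded; [eta (rtr rho)] is
    the entropy of the remaining 1 by 1 marginal. *)
Lemma centropy_le_marginal (Q X : finType) (rho : mx (Q * X) (Q * X)) :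
  psd rho -> centropy rho <= entropy (ptr2 rho) - Defs.eta (rtr rho).
Proof.
move=> h; pose rho' : mx (Q * (unit * X)) (Q * (unit * X)) :=
  fun a b => rho (a.1, a.2.2) (b.1, b.2.2).
have bf : bijective (fun a : Q * (unit * X) => (a.1, a.2.2)).
  by exists (fun a => (a.1, (tt, a.2))) => [[q [[] x]]|[q x]].
have bg : bijective (fun a : unit * X => a.2).
  by exists (fun x => (tt, x)) => [[[] x]|x].
have bh : bijective (fun a : Q * unit => a.1).
  by exists (fun x => (x, tt)) => [[x []]|x].
have h' : psd rho' by exact: (psd_reindex (fun a : Q * (unit * X) => (a.1, a.2.2)) h).
have := strong_subadditivity h'; rewrite /centropy.
have -> : entropy rho' = entropy rho by exact: (entropy_reindex bf h).
have -> : entropy (ptr1 rho') = entropy (ptr1 rho).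
  exact: (entropy_reindex bg (psd_ptr1 h)).
have -> : entropy (ptr_last rho') = entropy (ptr2 rho).
  exact: (entropy_reindex bh (psd_ptr2 h)).
rewrite entropy_unit; last exact: (psd_ptr1 (psd_ptr_last h')).
rewrite rtr_ptr1 /rtr mtrace_ptr_last.
suff -> : mtrace rho' = mtrace rho by [].
rewrite /mtrace (reindex (fun a : Q * (unit * X) => (a.1, a.2.2))) //.
exact: onW_bij.
Qed.

Definition complementary (Q X K : finType) (Y : mx (Q * X) K) : mx (Q * K) X :=
  fun a x => Y (a.1, x) a.2.

(** [Y] is a vector on [Q], [X] and [K]. Complementary marginals of a vector have equal entropy, so
    exchanging [X] with [K] exchanges the two terms of the conditional entropy. *)
Lemma centropy_dual (Q X K : finType) (Y : mx (Q * X) K) :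
  centropy (gram Y) = - centropy (gram (complementary Y)).
Proof.
rewrite /centropy entropy_gram_trm [entropy (gram (complementary Y))]entropy_gram_trm opprB.
congr (_ - _); congr entropy; apply: mxext => a b.
  by rewrite gramE sum_pair.
by rewrite gramE sum_pair.
Qed.

Lemma centropy_ge_marginal (Q X : finType) (rho : mx (Q * X) (Q * X)) :
  psd rho -> Defs.eta (rtr rho) - entropy (ptr2 rho) <= centropy rho.
Proof.
move=> /psd_gramP[Y ->]; rewrite centropy_dual lerNr opprB.
have e : ptr2 (gram Y) = ptr2 (gram (complementary Y)).
  by apply: mxext => q q'; rewrite /ptr2 exchange_big.
rewrite -rtr_ptr2 e rtr_ptr2.
exact/centropy_le_marginal/gram_psd.
Qed.

Lemma centropy_le_dim (Q X : finType) (rho : mx (Q * X) (Q * X)) :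
  psd rho -> `|centropy rho| <= rtr rho * log2 #|Q|%:R.
Proof.
move=> h; have h1 := centropy_le_marginal h; have h2 := centropy_ge_marginal h.
have := entropy_le_log (psd_ptr2 h); rewrite rtr_ptr2 => h3.
by rewrite ler_norml; apply/andP; split; lra.
Qed.

(** Attach a classical bit that tells [rho] from [tau] to the conditioning system; discarding it can
    only raise the conditional entropy. *)
Lemma centropy_superadd (Q X : finType) (rho tau : mx (Q * X) (Q * X)) :
  psd rho -> psd tau -> centropy rho + centropy tau <= centropy (madd rho tau).
Proof.
move=> hr ht; pose S (f : bool) := if f then rho else tau.
have hS f : psd (S f) by case: f.
pose s : mx (Q * (X * bool)) (Q * (X * bool)) :=
  fun a b => flag S ((a.1, a.2.1), a.2.2) ((b.1, b.2.1), b.2.2).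
have bf : bijective (fun a : Q * (X * bool) => ((a.1, a.2.1), a.2.2)).
  by exists (fun a => (a.1.1, (a.1.2, a.2))) => [[q [x f]]|[[q x] f]].
have hs : psd s.
  exact: (psd_reindex (fun a : Q * (X * bool) => ((a.1, a.2.1), a.2.2)) (flag_psd hS)).
have := strong_subadditivity hs; rewrite /centropy.
have -> : entropy s = entropy rho + entropy tau.
  by rewrite (entropy_reindex bf (flag_psd hS)) entropy_flag // big_bool.
have -> : ptr1 s = flag (fun f => ptr1 (S f)).
  by apply: mxext => -[x f] [x' f']; rewrite /ptr1 /s /flag /= mulr_sumr.
rewrite entropy_flag => [|f]; last exact: psd_ptr1.
rewrite big_bool /=.
have -> : ptr_last s = madd rho tau.
  apply: mxext => -[q x] [q' x']; rewrite /ptr_last /s /flag /madd big_bool /=.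
  by rewrite !mul1r.
lra.
Qed.

(** The previous superadditivity with a one-dimensional conditioning system, whose own entropy gives
    the [eta] corrections. *)
Lemma entropy_superadd (I : finType) (X Y : mx I I) : psd X -> psd Y ->
  entropy X + entropy Y - (Defs.eta (rtr X) + Defs.eta (rtr Y) - Defs.eta (rtr X + rtr Y))
  <= entropy (madd X Y).
Proof.
move=> hX hY.
pose e (Z : mx I I) : mx (I * unit) (I * unit) := fun a b => Z a.1 b.1.
have bf : bijective (fun a : I * unit => a.1).
  by exists (fun x => (x, tt)) => [[x []]|x].
have he Z : psd Z -> psd (e Z) by exact: psd_reindex.
have ce Z : psd Z -> centropy (e Z) = entropy Z - Defs.eta (rtr Z).
  move=> hZ; rewrite /centropy (entropy_reindex bf hZ); congr (_ - _).
  rewrite entropy_unit; last exact/psd_ptr1/he.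
  by rewrite rtr_ptr1 -rtr_ptr2 /rtr /mtrace; congr (Defs.eta (complex.Re _));
    apply: eq_bigr => i _; rewrite /ptr2 (big_pred1 tt) // => -[].
have := centropy_superadd (he _ hX) (he _ hY).
have -> : madd (e X) (e Y) = e (madd X Y) by [].
rewrite !ce // ?rtr_madd; first by lra.
exact: psd_madd.
Qed.

(** The isometry [W] copies the classical flag. Given [I] and the original flag, the copy has
    conditional entropy zero; strong subadditivity then makes its conditional entropy given [I]
    alone nonnegative. *)
Lemma entropy_subadd_sum (I : finType) (X Y : mx I I) : psd X -> psd Y ->
  entropy (madd X Y) <= entropy X + entropy Y.
Proof.
move=> hX hY; pose S (f : bool) := if f then X else Y.
have hS f : psd (S f) by case: f.
pose W : mx (bool * (I * bool)) (I * bool) := fun a b => (a.1 == a.2.2)%:R * (a.2 == b)%:R.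
have hW : isometry W.
  apply: mxext => -[i f] [j g]; rewrite /mxmul sum_pair exchange_big /=.
  rewrite /idm -[RHS](sum_deltal (fun p => (p == (j, g))%:R)); apply: eq_bigr => -[k h] _.
  rewrite big_bool /adj /W /= !conjM !conjCn [(k, h) == (i, f)]eq_sym.
  by case: h; rewrite /= !(mul0r, mul1r, addr0, add0r).
have hs : psd (conjmx W (flag S)) by exact/psd_conjmx/flag_psd.
have sE a b : conjmx W (flag S) a b =
    (a.1 == a.2.2)%:R * (b.1 == b.2.2)%:R * flag S a.2 b.2.
  rewrite -[RHS](sum_deltal (fun q => (a.1 == a.2.2)%:R * (b.1 == b.2.2)%:R * flag S a.2 q)).
  apply: eq_bigr => q _; rewrite /mxmul.
  under eq_bigr do rewrite /W -mulrA.
  by rewrite -mulr_sumr sum_deltal /adj /W conjM !conjCn; ring.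
have := strong_subadditivity hs; rewrite /centropy.
rewrite entropy_isometry //; last exact: flag_psd.
have -> : ptr1 (conjmx W (flag S)) = flag S.
  apply: mxext => a b; rewrite /ptr1; under eq_bigr do rewrite sE /=.
  case: a b => [i f] [j g]; rewrite /flag /= big_bool /=.
  by case: f; case: g; rewrite /= !(mul0r, mul1r, mulr0, addr0, add0r).
have bf : bijective (fun a : bool * I => (a.2, a.1)).
  by exists (fun a => (a.2, a.1)) => [[]|[]].
have -> : ptr_last (conjmx W (flag S)) = fun a b => flag S (a.2, a.1) (b.2, b.1).
  apply: mxext => -[f i] [g j]; rewrite /ptr_last; under eq_bigr do rewrite sE /=.
  rewrite /flag /= big_bool /=.
  by case: f; case: g; rewrite /= !(mul0r, mul1r, mulr0, addr0, add0r).
rewrite (entropy_reindex bf (flag_psd hS)).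
have -> : ptr1 (fun a b => flag S (a.2, a.1) (b.2, b.1)) = madd X Y.
  by apply: mxext => i j; rewrite /ptr1 /flag big_bool /= !mul1r.
rewrite entropy_flag // big_bool /=; lra.
Qed.

(** Subadditivity bounds the joint entropy and superadditivity the subtracted marginal; only the
    second costs [eta] terms. *)
Lemma centropy_subadd_mix (Q X : finType) (rho tau : mx (Q * X) (Q * X)) :
  psd rho -> psd tau -> centropy (madd rho tau) <= centropy rho + centropy tau +
    (Defs.eta (rtr rho) + Defs.eta (rtr tau) - Defs.eta (rtr rho + rtr tau)).
Proof.
move=> hr ht; rewrite /centropy ptr1_madd.
have h1 := entropy_subadd_sum hr ht.
have := entropy_superadd (psd_ptr1 hr) (psd_ptr1 ht); rewrite !rtr_ptr1.
lra.
Qed.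

(* The Alicki-Fannes-Winter argument: rho and sg have a common majorant whose
   two defects have trace d. *)
Lemma centropy_continuity (Q X : finType) (rho sg T T' : mx (Q * X) (Q * X)) (d : R) :
  psd rho -> psd sg -> psd T -> psd T' -> rtr rho = 1 -> rtr sg = 1 ->
  rtr T = d -> rtr T' = d -> madd rho T' = madd sg T ->
  centropy rho - centropy sg <=
    2 * d * log2 #|Q|%:R + (1 + d) * hbin (d / (1 + d)).
Proof.
move=> hr hs hT hT' r1 s1 td td' e.
have h1 := centropy_superadd hr hT'.
have h2 := centropy_subadd_mix hs hT.
rewrite e in h1; rewrite s1 td eta1 in h2.
have := centropy_le_dim hT; have := centropy_le_dim hT'.
rewrite td td' !ler_norml => /andP[h3 _] /andP[_ h4].
have d0 : 0 <= d by rewrite -td; exact: rtr_ge0.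
(* The binary entropy term is the [eta] correction of the mixture of [sg] and [T], of traces 1 and
   [d], as [eta 1 = 0]. *)
have -> : (1 + d) * hbin (d / (1 + d)) = Defs.eta d - Defs.eta (1 + d).
  have d1 : 0 < 1 + d by lra.
  have -> : hbin (d / (1 + d)) = Defs.eta (d / (1 + d)) + Defs.eta (1 / (1 + d)).
    by rewrite /hbin; congr (_ + Defs.eta _); field; exact: lt0r_neq0.
  apply: (mulfI (lt0r_neq0 (ln2_gt0 R))).
  have -> : ln 2 * ((1 + d) * (Defs.eta (d / (1 + d)) + Defs.eta (1 / (1 + d)))) =
     (1 + d) * (ln 2 * Defs.eta (d / (1 + d)) + ln 2 * Defs.eta (1 / (1 + d))) by ring.
  rewrite mulrBr !ln2_eta mul1r lnV ?posrE //.
  have [->|n] := eqVneq d 0; first by rewrite !(mul0r, addr0, oppr0) ln1; ring.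
  rewrite ln_div ?posrE // ?lt_def ?n ?d0 //.
  by field; exact: lt0r_neq0.
lra.
Qed.

(** By the chain rule, S(Q|XY) - S(Q|X) = S(Y|QX) - S(Y|X). The first term is at least -S(Y) and the
    second at most S(Y). *)
Lemma centropy_ptr_last_ge (Q X Y : finType) (rho : mx (Q * (X * Y)) (Q * (X * Y))) :
  psd rho -> rtr rho = 1 ->
  centropy (ptr_last rho) - 2 * entropy (ptr1 (ptr1 rho)) <= centropy rho.
Proof.
move=> h r1.
pose s : mx (Y * (Q * X)) (Y * (Q * X)) := fun a b => rho (a.2.1, (a.2.2, a.1)) (b.2.1, (b.2.2, b.1)).
pose s' : mx (Y * X) (Y * X) := fun a b => ptr1 rho (a.2, a.1) (b.2, b.1).
have bf : bijective (fun a : Y * (Q * X) => (a.2.1, (a.2.2, a.1))).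
  by exists (fun a => (a.2.2, (a.1, a.2.1))) => [[? []]|[? []]].
have bg : bijective (fun a : Y * X => (a.2, a.1)).
  by exists (fun a => (a.2, a.1)) => [[]|[]].
have hs : psd s by exact: (psd_reindex (fun a : Y * (Q * X) => (a.2.1, (a.2.2, a.1))) h).
have hs' : psd s' by exact: (psd_reindex (fun a : Y * X => (a.2, a.1)) (psd_ptr1 h)).
have e2 : ptr2 s = ptr1 (ptr1 rho).
  apply: mxext => y y'; rewrite /ptr2 /ptr1 sum_pair exchange_big /=.
  by apply: eq_bigr.
have e2' : ptr2 s' = ptr1 (ptr1 rho) by [].
have es : rtr s = 1 by rewrite -rtr_ptr2 e2 !rtr_ptr1.
have es' : rtr s' = 1 by rewrite -rtr_ptr2 e2' !rtr_ptr1.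
have := centropy_ge_marginal hs; have := centropy_le_marginal hs'.
rewrite e2 e2' es es' eta1 /centropy (entropy_reindex bf h) (entropy_reindex bg (psd_ptr1 h)).
have -> : ptr1 s = ptr_last rho by [].
have -> : ptr1 s' = ptr1 (ptr_last rho).
  by apply: mxext => x x'; rewrite /ptr1 /ptr_last exchange_big.
lra.
Qed.

End ConditionalEntropy.

(** * Kraus operators and the diamond distance *)

Section Channels.
Variable R : realType.
Local Notation C := (R[i]).
Local Notation mx := (mx R).
Local Notation lmap := (lmap R).

(** Stated on matrix units only, which is all that [tensmap] evaluates. *)
Definition kraus_of (I J E : finType) (N : lmap I J) (n : E -> mx J I) :=
  forall i i' j j', N (ebasis R i i') j j' = \sum_e n e j i * (n e j' i')^*.

Lemma kraus_idmap (I : finType) : kraus_of (@idmap R I) (fun _ : unit => @idm R I).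
Proof.
move=> i i' j j'; rewrite (big_pred1 tt) => [|[]] //.
by rewrite /idmap /ebasis /idm conjCn -natrM mulnb.
Qed.

Lemma kraus_uchan (I : finType) (U : mx I I) : kraus_of (uchan U) (fun _ : unit => U).
Proof.
move=> i i' j j'; rewrite (big_pred1 tt) => [|[]] //.
rewrite -[RHS](sum_deltar (fun k => U j i * (U j' k)^*)); apply: eq_bigr => k _.
rewrite mulrAC; congr (_ * _); rewrite /mxmul /ebasis.
under eq_bigr do rewrite -mulnb natrM mulrA.
by rewrite -mulr_suml sum_deltar.
Qed.

Definition tens_vec (I J I' J' M E1 E2 : finType) (n1 : E1 -> mx J I) (n2 : E2 -> mx J' I')
  (f : M -> I * I' -> C) (k : M * (E1 * E2)) (p : J * J') : C :=
  \sum_(z : I * I') n1 k.2.1 p.1 z.1 * n2 k.2.2 p.2 z.2 * f k.1 z.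

(** The families [f] and [f'] may differ, so that matrix units are covered. The conclusion has the
    shape of the hypothesis on [X], so the lemma can be applied round after round. *)
Lemma tens_kraus (I J I' J' M E1 E2 : finType) (N1 : lmap I J) (N2 : lmap I' J')
  (n1 : E1 -> mx J I) (n2 : E2 -> mx J' I') (f f' : M -> I * I' -> C)
  (X : mx (I * I') (I * I')) :
  kraus_of N1 n1 -> kraus_of N2 n2 ->
  (forall p q, X p q = \sum_m f m p * (f' m q)^*) ->
  forall p q, tensmap N1 N2 X p q =
    \sum_k tens_vec n1 n2 f k p * (tens_vec n1 n2 f' k q)^*.
Proof.
move=> h1 h2 hX p q.
pose t (k : M * (E1 * E2)) (z w : I * I') : C :=
  n1 k.2.1 p.1 z.1 * n2 k.2.2 p.2 z.2 * f k.1 z *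
  (n1 k.2.1 q.1 w.1 * n2 k.2.2 q.2 w.2 * f' k.1 w)^*.
transitivity (\sum_z \sum_w \sum_k t k z w); last first.
  under eq_bigr do rewrite exchange_big.
  rewrite exchange_big; apply: eq_bigr => k _.
  rewrite /tens_vec mulr_suml; apply: eq_bigr => z _.
  by rewrite conj_sum mulr_sumr.
rewrite /tensmap sum_pair; apply: eq_bigr => i _.
rewrite exchange_big; apply: eq_bigr => j _ /=.
rewrite sum_pair; apply: eq_bigr => i' _; apply: eq_bigr => j' _.
rewrite hX h1 h2 !sum_pair mulr_suml mulr_suml; apply: eq_bigr => m _.
rewrite sum_pair [X in X * _]mulr_sumr mulr_suml; apply: eq_bigr => e1 _.
rewrite mulr_sumr; apply: eq_bigr => e2 _.
by rewrite /t /= !conjM; ring.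
Qed.

(** Choi's argument: [X] is the unnormalised maximally entangled operator, its image is positive,
    and the columns of a Gram factor of that image are Kraus operators. *)
Lemma channel_kraus (I J : finType) (N : lmap I J) : channel N ->
  exists n : ('I_#|I| * J) -> mx J I, kraus_of N n /\
    forall i i', \sum_e \sum_j (n e j i)^* * n e j i' = (i == i')%:R.
Proof.
move=> [_ hcp htp].
pose X : mx ('I_#|I| * I) ('I_#|I| * I) :=
  fun p q => (enum_val p.1 == p.2)%:R * (enum_val q.1 == q.2)%:R.
have hX : psd X.
  suff -> : X = gram (fun p (_ : unit) => (enum_val p.1 == p.2)%:R) by exact: gram_psd.
  by apply: mxext => p q; rewrite gramE (big_pred1 tt) => [|[]] //; rewrite conjCn.
have [Y eY] := psd_gramP (hcp _ _ hX).
pose n (e : 'I_#|I| * J) : mx J I := fun j i => Y (enum_rank i, j) e.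
have hn : kraus_of N n.
  move=> i i' j j'; have := congr1 (fun Z => Z (enum_rank i, j) (enum_rank i', j')) eY.
  rewrite gramE => <-; rewrite /tensmap /idmap /ebasis /= -/(ebasis R _ _).
  rewrite -[LHS](sum_deltal (fun i0 => N (ebasis R i i') j j') (enum_rank i)).
  apply: eq_bigr => i0 _.
  have [<-|ne] := eqVneq (enum_rank i) i0; last first.
    rewrite mul0r big1 // => i1 _; rewrite big1 // => j0 _; rewrite big1 // => j1 _.
    by rewrite /= mulr0 mul0r.
  rewrite mul1r -[LHS](sum_deltal (fun i0 => N (ebasis R i i') j j') (enum_rank i')).
  apply: eq_bigr => i1 _.
  have [<-|ne] := eqVneq (enum_rank i') i1; last first.
    rewrite mul0r big1 // => j0 _; rewrite big1 // => j1 _.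
    by rewrite /= mulr0 mul0r.
  rewrite mul1r -[LHS](sum_deltal (fun j0 => N (ebasis R j0 i') j j') i).
  apply: eq_bigr => j0 _.
  rewrite -[in LHS](sum_deltal (fun j1 => N (ebasis R j0 j1) j j') i') mulr_sumr.
  by apply: eq_bigr => j1 _; rewrite /X /= !enum_rankK mulr1 !mulrA.
exists n; split=> // i i'.
(* Trace preservation on matrix units is the completeness relation. *)
have := htp (ebasis R i' i); rewrite /mtrace.
under eq_bigr do rewrite hn; rewrite exchange_big => h.
have -> : (i == i')%:R = \sum_i0 ebasis R i' i i0 i0 :> C.
  rewrite -(sum_deltal (fun k => (k == i')%:R)); apply: eq_bigr => k _.
  by rewrite /ebasis -mulnb natrM mulrC (eq_sym k i).
rewrite -h; apply: eq_bigr => e _; apply: eq_bigr => j _; exact: mulrC.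
Qed.

(** In the singular bases the form is a sum of [s k] times a product of two coordinates of unit
    vectors, and such a product has real part at least -1. *)
Lemma svals_form_ge (I : finType) (X : mx I I) (s : I -> R) (v : I -> C) :
  svals X s -> unit_vector v ->
  - (\sum_i s i) <= complex.Re (\sum_i \sum_j (v i)^* * X i j * v j).
Proof.
move=> [s0 [U [V [hU hV ->]]]] hv.
pose z1 : mx unit I := mxmul (adj (fun i (_ : unit) => v i)) U.
pose z2 : mx I unit := mxmul V (fun i (_ : unit) => v i).
have hvv : mxmul (adj (fun i (_ : unit) => v i)) (fun i (_ : unit) => v i) = @idm R unit.
  by apply: mxext => -[] []; rewrite /mxmul /adj hv /idm eqxx.
have -> : \sum_i \sum_j (v i)^* * mxmul (mxmul U (diagm (fun i => (s i)%:C%C))) V i j * v j =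
    \sum_k (s k)%:C%C * (z1 tt k * z2 k tt).
  transitivity (mxmul (mxmul z1 (diagm (fun i => (s i)%:C%C))) z2 tt tt).
    rewrite /z1 /z2 mxmulA -!(mxmulA (adj _)) mxmulA /mxmul exchange_big /=.
    by apply: eq_bigr => j _; rewrite mulr_suml.
  by apply: eq_bigr => k _; rewrite -/(mxmul z1 _ tt k) mul_diagr; ring.
have n1 : \sum_k nsq (z1 tt k) = 1.
  apply: (@complexI R); rewrite -gram_diag /gram /z1 adjM -!mxmulA (mxmulA U).
  by rewrite (unitary_adjr hU) mxmul1l adjK hvv /idm eqxx.
have n2 : \sum_k nsq (z2 k tt) = 1.
  apply: (@complexI R); rewrite -gram_adj_diag /z2 adjM -!mxmulA (mxmulA (adj V)).
  by rewrite hV mxmul1l hvv /idm eqxx.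
rewrite Re_sum -sumrN; apply: ler_sum => k _; rewrite ReZ.
have le1 (f : I -> R) : (forall i, 0 <= f i) -> \sum_k f k = 1 -> f k <= 1.
  by move=> f0 <-; rewrite (bigD1 k) //= lerDl sumr_ge0.
have l1 := le1 _ (fun i => nsq_ge0 (z1 tt i)) n1.
have l2 := le1 _ (fun i => nsq_ge0 (z2 i tt)) n2.
rewrite -[X in X <= _]mulrN1 ler_wpM2l //.
move: l1 l2; case: (z1 tt k) (z2 k tt) => a b [c d]; rewrite /nsq /= => l1 l2.
have := sqr_ge0 (a + c); have := sqr_ge0 (b - d); nra.
Qed.

Lemma hermitian_svals (I : finType) (X : mx I I) : adj X = X -> exists s, svals X s.
Proof.
move=> /hermitian_spectrum [l [U [hU eX]]].
(* The signs of the eigenvalues are absorbed into the right unitary; zero gets sign 1 so that the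
   sign matrix is unitary. *)
pose sg i : R := if 0 <= l i then 1 else -1.
exists (fun i => `|l i|); split; first by move=> i; exact: normr_ge0.
exists U, (mxmul (diagm (fun i => (sg i)%:C%C)) (adj U)); split=> //.
  apply: unitaryM; last exact: unitary_adj.
  rewrite /unitary; have := adj_rdiag sg; rewrite /rdiag => ->.
  apply: mxext => i j; rewrite mul_diagl /diagm /idm mulrCA -(rmorphM (real_complex R)) /=.
  case: eqP => [->|]; last by rewrite mul0r.
  by rewrite /sg mul1r; case: ifP => _; rewrite ?mulrNN mulr1.
rewrite eX -!mxmulA; congr mxmul; rewrite mxmulA; congr mxmul.
apply: mxext => i j; rewrite mul_diagl /diagm mulrCA -(rmorphM (real_complex R)) /=.
case: eqP => [->|]; last by rewrite !mul0r.
rewrite /sg !mul1r; case: ifP => h; first by rewrite ger0_norm ?mulr1.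
by rewrite ltr0_norm ?mulrN1 ?opprK // ltNge h.
Qed.

Lemma trnorm_form_ge (I : finType) (X : mx I I) (v : I -> C) :
  adj X = X -> unit_vector v ->
  - trnorm X <= complex.Re (\sum_i \sum_j (v i)^* * X i j * v j).
Proof.
move=> hX hv; apply: svals_form_ge => //.
by apply: ClassicalEpsilon.epsilon_spec; exact: hermitian_svals.
Qed.

Lemma form_gram (I E : finType) (f : E -> I -> C) (v : I -> C) (X : mx I I) :
  (forall p q, X p q = \sum_e f e p * (f e q)^*) ->
  \sum_i \sum_j (v i)^* * X i j * v j = (\sum_e nsq (\sum_i (v i)^* * f e i))%:C%C.
Proof.
move=> hX; rewrite real_sum.
transitivity (\sum_e \sum_i \sum_j (v i)^* * (f e i * (f e j)^*) * v j).
  rewrite [RHS]exchange_big; apply: eq_bigr => i _; rewrite exchange_big.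
  by apply: eq_bigr => j _; rewrite hX mulr_sumr mulr_suml.
apply: eq_bigr => e _; rewrite -mul_conj conj_sum mulr_suml; apply: eq_bigr => i _.
by rewrite mulr_sumr; apply: eq_bigr => j _; rewrite conjM conjCK; ring.
Qed.

(** The difference of the two outputs is tested on the ideal output vector [u]. The ideal term
    equals 1, the form is at least [- eps], and the other term is the sum of squared overlaps over
    the Kraus branches. *)
Lemma diamond_fidelity (S I E : finType) (N : lmap I I) (n : E -> mx I I) (U : mx I I)
    (xi : S -> I -> C) (eps : R) :
  kraus_of N n -> unitary U -> \sum_s \sum_i nsq (xi s i) = 1 ->
  diamond_close N (uchan U) eps ->
  1 - eps <= \sum_e nsq (\sum_s \sum_i (\sum_j U i j * xi s j)^* * (\sum_j n e i j * xi s j)).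
Proof.
move=> hn hU hxi hd.
pose x (_ : unit) (p : 'I_#|S| * I) := xi (enum_val p.1) p.2.
pose X : mx ('I_#|S| * I) ('I_#|S| * I) := pure (x tt).
have xE p q : X p q = \sum_m x m p * (x m q)^* by rewrite (big_pred1 tt) // => -[].
have sumS (F : S -> C) : \sum_s F s = \sum_(i < #|S|) F (enum_val i).
  rewrite (reindex (@enum_val S predT)) //=.
  by exists enum_rank => y _; rewrite ?enum_valK ?enum_rankK.
have hX : state X.
  split.
    suff -> : X = gram (fun p (u : unit) => x u p) by exact: gram_psd.
    by apply: mxext => p q; rewrite xE.
  rewrite /mtrace sum_pair; transitivity ((\sum_s \sum_i nsq (xi s i))%:C%C : C); last by rewrite hxi.
  rewrite real_sum sumS; apply: eq_bigr => s _; rewrite real_sum; apply: eq_bigr => i _.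
  by rewrite -mul_conj.
have e1 := tens_kraus (@kraus_idmap _) hn xE.
have e2 := tens_kraus (@kraus_idmap _) (@kraus_uchan _ U) xE.
set g1 := tens_vec _ _ _ in e1; set g2 := tens_vec _ _ _ in e2.
have gE (E' : finType) (m : E' -> mx I I) k p :
    tens_vec (fun _ : unit => @idm R 'I_#|S|) m x k p =
    \sum_j m k.2.2 p.2 j * xi (enum_val p.1) j.
  rewrite /tens_vec sum_pair -[RHS](sum_deltal (fun s => \sum_j m k.2.2 p.2 j * xi (enum_val s) j)).
  apply: eq_bigr => s _; rewrite mulr_sumr; apply: eq_bigr => j _.
  by rewrite /x /idm /= mulrA.
pose u (p : 'I_#|S| * I) := \sum_j U p.2 j * xi (enum_val p.1) j.
have e2' p q : tensmap (@idmap R _) (uchan U) X p q = \sum_(m : unit) u p * (u q)^*.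
  rewrite e2 !sum_pair (big_pred1 tt) => [|[]] //; rewrite sum_pair (big_pred1 tt) => [|[]] //.
  by rewrite [RHS](big_pred1 tt) => [|[]] //; rewrite (big_pred1 tt) => [|[]] //; rewrite /g2 !gE.
have hu : unit_vector u.
  rewrite /unit_vector sum_pair.
  transitivity (\sum_(s < #|S|) \sum_i (xi (enum_val s) i)^* * xi (enum_val s) i); last first.
    rewrite -(sumS (fun s => \sum_i (xi s i)^* * xi s i)).
    transitivity ((\sum_s \sum_i nsq (xi s i))%:C%C : C); last by rewrite hxi.
    rewrite real_sum; apply: eq_bigr => s _; rewrite real_sum; apply: eq_bigr => i _.
    by rewrite mulrC mul_conj.
  apply: eq_bigr => s _; pose y : mx I unit := fun i _ => xi (enum_val s) i.
  have -> : \sum_i (u (s, i))^* * u (s, i) = mxmul (adj (mxmul U y)) (mxmul U y) tt tt by [].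
  by rewrite adjM -mxmulA (mxmulA (adj U)) hU mxmul1l.
pose D := msub (tensmap (@idmap R _) N X) (tensmap (@idmap R _) (uchan U) X).
have hD : adj D = D.
  apply: mxext => p q; rewrite /adj /D /msub !e1 !e2 conjB !conj_sum; congr (_ - _);
  by apply: eq_bigr => k _; rewrite conjM conjCK mulrC.
have := trnorm_form_ge hD hu; have := hd _ _ hX; rewrite -/D => h1 h2.
have {h1 h2} : - eps <= complex.Re (\sum_i \sum_j (u i)^* * D i j * u j).
  by apply: le_trans h2; rewrite lerN2.
have -> : \sum_i \sum_j (u i)^* * D i j * u j =
   \sum_i \sum_j (u i)^* * tensmap (@idmap R _) N X i j * u j -
   \sum_i \sum_j (u i)^* * tensmap (@idmap R _) (uchan U) X i j * u j.
  rewrite -sumrB; apply: eq_bigr => i _; rewrite -sumrB; apply: eq_bigr => j _.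
  by rewrite /D /msub; ring.
rewrite (form_gram u e1) (form_gram u e2') ReB /=.
rewrite (big_pred1 tt) => [|[]] //.
have -> : nsq (\sum_i (u i)^* * u i) = 1 by rewrite hu nsq_real expr1n.
have -> : \sum_e nsq (\sum_i (u i)^* * g1 e i) =
   \sum_e nsq (\sum_s \sum_i (\sum_j U i j * xi s j)^* * (\sum_j n e i j * xi s j)).
  rewrite -(pair_bigA _ (fun m e => nsq (\sum_i (u i)^* * g1 (m, e) i))) /= (big_pred1 tt) => [|[]] //.
  rewrite -(pair_bigA _ (fun m e => nsq (\sum_i (u i)^* * g1 (tt, (m, e)) i))) /= (big_pred1 tt) => [|[]] //.
  apply: eq_bigr => e _; congr nsq; rewrite sum_pair sumS; apply: eq_bigr => s _.
  by apply: eq_bigr => i _; rewrite /g1 gE.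
lra.
Qed.

End Channels.

(** * Continuity near product states *)

Section Decoupling.
Variable R : realType.
Local Notation C := (R[i]).
Local Notation mx := (mx R).

Lemma etaM (x y : R) : 0 <= x -> 0 <= y ->
  Defs.eta (x * y) = y * Defs.eta x + x * Defs.eta y.
Proof.
move=> x0 y0; apply: (mulfI (lt0r_neq0 (ln2_gt0 R))).
have -> : ln 2 * (y * Defs.eta x + x * Defs.eta y) =
  y * (ln 2 * Defs.eta x) + x * (ln 2 * Defs.eta y) by ring.
rewrite !ln2_eta.
have [->|xn] := eqVneq x 0; first by rewrite !(mul0r, oppr0, mulr0, addr0).
have [->|yn] := eqVneq y 0; first by rewrite !(mul0r, oppr0, mulr0, addr0).
by rewrite lnM ?posrE ?lt_def ?xn ?yn //; ring.
Qed.

Lemma entropy_kron (I J : finType) (X : mx I I) (Y : mx J J) : psd X -> psd Y ->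
  entropy (kron X Y) = rtr Y * entropy X + rtr X * entropy Y.
Proof.
move=> /psd_spectrum[l [hl l0]] /psd_spectrum[m [hm m0]].
rewrite (entropy_spectrum hl) (entropy_spectrum hm) (rtr_spectrum hl) (rtr_spectrum hm).
rewrite (@entropy_spectrum _ _ _ (fun p => l p.1 * m p.2)).
  rewrite -(pair_bigA _ (fun i j => Defs.eta (l i * m j))) /= mulr_sumr mulr_suml -big_split.
  apply: eq_bigr => i _ /=; rewrite mulr_suml mulr_sumr -big_split.
  by apply: eq_bigr => j _; rewrite etaM.
move: hl hm => [U [hU ->]] [V [hV ->]]; exists (kron U V); split.
  by rewrite /unitary kron_adj kron_mul hU hV kron_idm.
have -> : diagm (fun p => (l p.1 * m p.2)%:C%C) =
   kron (diagm (fun i => (l i)%:C%C)) (diagm (fun i => (m i)%:C%C)).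
  apply: mxext => -[i j] [i' j']; rewrite /diagm /kron /= xpair_eqE -mulnb natrM.
  by rewrite (rmorphM (real_complex R)) /=; ring.
by rewrite kron_adj !kron_mul.
Qed.

Lemma psd_kron (I J : finType) (X : mx I I) (Y : mx J J) : psd X -> psd Y -> psd (kron X Y).
Proof.
move=> /psd_gramP[A ->] /psd_gramP[B ->]; rewrite /gram -kron_mul -kron_adj.
exact: gram_psd.
Qed.

Lemma rtr_kron (I J : finType) (X : mx I I) (Y : mx J J) : psd X -> psd Y ->
  rtr (kron X Y) = rtr X * rtr Y.
Proof.
move=> hX hY; have [l [hl _]] := psd_spectrum hX; have [m [hm _]] := psd_spectrum hY.
rewrite /rtr; have -> : mtrace (kron X Y) = mtrace X * mtrace Y.
  rewrite /mtrace sum_pair mulr_suml; apply: eq_bigr => i _.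
  by rewrite mulr_sumr.
by rewrite (mtrace_spectrum hl) ReZ.
Qed.

Definition assoc (Q X E : finType) (rho : mx ((Q * X) * E) ((Q * X) * E)) :
  mx (Q * (X * E)) (Q * (X * E)) :=
  fun a b => rho ((a.1, a.2.1), a.2.2) ((b.1, b.2.1), b.2.2).

Lemma assoc_bij (Q X E : finType) : bijective (fun a : Q * (X * E) => ((a.1, a.2.1), a.2.2)).
Proof. by exists (fun a => (a.1.1, (a.1.2, a.2))) => [[q [x f]]|[[q x] f]]. Qed.

Lemma psd_assoc (Q X E : finType) (rho : mx ((Q * X) * E) ((Q * X) * E)) :
  psd rho -> psd (assoc rho).
Proof. exact: psd_reindex. Qed.

Lemma rtr_assoc (Q X E : finType) (rho : mx ((Q * X) * E) ((Q * X) * E)) :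
  rtr (assoc rho) = rtr rho.
Proof.
rewrite /rtr /mtrace [in RHS](reindex (fun a : Q * (X * E) => ((a.1, a.2.1), a.2.2))) //.
exact: onW_bij (@assoc_bij Q X E).
Qed.

(** An uncorrelated normalised environment adds the same entropy to both terms of the difference. *)
Lemma centropy_assoc_kron (Q X E : finType) (rho : mx (Q * X) (Q * X)) (v : mx E E) :
  psd rho -> psd v -> rtr v = 1 -> centropy (assoc (kron rho v)) = centropy rho.
Proof.
move=> hr hv v1; rewrite /centropy.
have -> : entropy (assoc (kron rho v)) = entropy (kron rho v).
  exact: (entropy_reindex (@assoc_bij Q X E) (psd_kron hr hv)).
have -> : ptr1 (assoc (kron rho v)) = kron (ptr1 rho) v.
  by apply: mxext => -[x e] [x' e']; rewrite /ptr1 /assoc /kron /= mulr_suml.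
rewrite !entropy_kron //; last exact: psd_ptr1.
by rewrite rtr_ptr1 v1 !mul1r; ring.
Qed.

Lemma rtr_gram (I K : finType) (Y : mx I K) : rtr (gram Y) = \sum_i \sum_k nsq (Y i k).
Proof.
rewrite /rtr /mtrace; under eq_bigr do rewrite gram_diag.
by rewrite -real_sum.
Qed.

Lemma rtr_rscale (I : finType) c (X : mx I I) : rtr (rscale c X) = c * rtr X.
Proof. by rewrite /rtr /mtrace /rscale -mulr_sumr ReZ. Qed.

(** A weighted parallelogram identity: the cross terms cancel because [s * s' = 1]. *)
Lemma gram_parallelogram (I K : finType) (a b : mx I K) (s s' : R) : s * s' = 1 ->
  madd (gram (madd a b)) (gram (madd (rscale s a) (rscale (- s') b))) =
  madd (rscale (1 + s ^+ 2) (gram a)) (rscale (1 + s' ^+ 2) (gram b)).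
Proof.
move=> ss; apply: mxext => i j; rewrite /madd /rscale !gramE !mulr_sumr -!big_split.
apply: eq_bigr => k _ /=; rewrite !conjD !conjM !conj_real.
rewrite !(rmorphD (real_complex R)) !(rmorphN (real_complex R)) !rmorph1 !(rmorphXn (real_complex R)) /=.
have {}ss : s%:C%C * s'%:C%C = 1 :> C by rewrite -(rmorphM (real_complex R)) /= ss.
set x := a i k; set y := b i k; set x' := (a j k)^*; set y' := (b j k)^*.
set u := s%:C%C in ss *; set w := s'%:C%C in ss *.
transitivity ((1 + u ^+ 2) * (x * x') + (1 + w ^+ 2) * (y * y') + (1 - u * w) * (x * y' + y * x')).
  by ring.
by rewrite ss subrr mul0r addr0.
Qed.

Lemma centropy_continuity_abs (Q X : finType) (rho sg T T' : mx (Q * X) (Q * X)) (d : R) :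
  psd rho -> psd sg -> psd T -> psd T' -> rtr rho = 1 -> rtr sg = 1 ->
  rtr T = d -> rtr T' = d -> madd rho T' = madd sg T ->
  `|centropy rho - centropy sg| <=
    2 * d * log2 #|Q|%:R + (1 + d) * hbin (d / (1 + d)).
Proof.
move=> h1 h2 h3 h4 h5 h6 h7 h8 e; rewrite ler_norml; apply/andP; split.
  have := centropy_continuity h2 h1 h4 h3 h6 h5 h8 h7 (esym e); lra.
exact: (centropy_continuity h1 h2 h3 h4 h5 h6 h7 h8 e).
Qed.

Lemma maddA (I J : finType) (X Y W : mx I J) : madd X (madd Y W) = madd (madd X Y) W.
Proof. by apply: mxext => i j; rewrite /madd addrA. Qed.

(** Positivity of one of the defects below: with [r < 1 / 2], the subtracted amount is at most
    [3 / 2 * r ^+ 2], hence below [r]. *)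
Lemma defect_coef_ge0 (r beta : R) : 0 < r -> r ^+ 2 < 1 / 4 -> 0 <= beta ->
  beta <= r ^+ 2 -> 0 <= r - beta - r * beta.
Proof.
move=> r0 r14 b0 br; have rh : r < 1 / 2 by nra.
have : r * beta <= r * r ^+ 2 by rewrite ler_pM2l.
have : r * r ^+ 2 <= 1 / 2 * r ^+ 2 by rewrite ler_wpM2r ?sqr_ge0 // ltW.
nra.
Qed.

Section PureState.
Variables (Z E Zr Et : finType) (phi : mx Z Zr) (Om : mx (Z * E) (Zr * Et)) (eps : R).
Hypotheses (phi1 : \sum_i \sum_j nsq (phi i j) = 1) (Om1 : \sum_i \sum_j nsq (Om i j) = 1).
Hypothesis eps4 : eps < 1 / 4.

(** Partial inner product of [Om] with [phi]: the unnormalised environment vector that accompanies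
    the ideal output. *)
Let v : mx E Et := fun e et => \sum_z \sum_r (phi z r)^* * Om (z, e) (r, et).

Hypothesis fid : 1 - eps <= \sum_e \sum_et nsq (v e et).

(* With a = phi (x) v the component of Om along phi, b = Om - a and s^2 =
   sqrt eps, the parallelogram identity exhibits a common majorant. *)
Lemma near_product_majorant : exists (w : mx E E) (T T' : mx (Z * E) (Z * E)),
  [/\ psd w, rtr w = 1, psd T, psd T' &
   [/\ rtr T = 4 * Num.sqrt eps, rtr T' = 4 * Num.sqrt eps &
       madd (gram Om) T' = madd (kron (gram phi) w) T]].
Proof.
have [beta ebeta] : exists beta : R, beta = 1 - \sum_e \sum_et nsq (v e et) by eexists.
pose a : mx (Z * E) (Zr * Et) := kron phi v.
pose b := msub Om a.
have eOm : Om = madd a b by apply: mxext => i j; rewrite /madd /b /msub addrC subrK.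
have ga : gram a = kron (gram phi) (gram v) by rewrite /gram /a kron_adj kron_mul.
have hphi : psd (gram phi) by exact: gram_psd.
have hv : psd (gram v) by exact: gram_psd.
have ra : rtr (gram a) = 1 - beta.
  by rewrite ga rtr_kron // !rtr_gram phi1 mul1r ebeta opprB addrC subrK.
have rb : rtr (gram b) = beta.
  (* By the choice of [v], contracting [b] with [phi] gives zero, so the squared norms of [a] and
     [b] add up to that of [Om]. *)
  have orth : \sum_i \sum_j (a i j)^* * b i j = 0.
    transitivity (\sum_e \sum_et (v e et)^* * (\sum_z \sum_r (phi z r)^* * b (z, e) (r, et))).
      rewrite sum_pair exchange_big; apply: eq_bigr => e _ /=.
      under eq_bigr do rewrite sum_pair; under [RHS]eq_bigr do rewrite mulr_sumr.
      rewrite [RHS]exchange_big; apply: eq_bigr => z _ /=.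
      under [RHS]eq_bigr do rewrite mulr_sumr.
      rewrite [RHS]exchange_big; apply: eq_bigr => r _; apply: eq_bigr => et _ /=.
      by rewrite /a /kron conjM /=; ring.
    rewrite big1 // => e _; rewrite big1 // => et _.
    have -> : \sum_z \sum_r (phi z r)^* * b (z, e) (r, et) =
        v e et - \sum_z \sum_r (phi z r)^* * phi z r * v e et.
      rewrite {1}/v -sumrB; apply: eq_bigr => z _; rewrite -sumrB; apply: eq_bigr => r _.
      by rewrite /b /msub /a /kron /= mulrBr mulrA.
    have -> : \sum_z \sum_r (phi z r)^* * phi z r * v e et = v e et.
      under eq_bigr do rewrite -mulr_suml.
      rewrite -mulr_suml -[RHS]mul1r; congr (_ * _).
      transitivity ((\sum_z \sum_r nsq (phi z r))%:C%C : C); last by rewrite phi1.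
      rewrite real_sum; apply: eq_bigr => z _; rewrite real_sum; apply: eq_bigr => r _.
      by rewrite mulrC mul_conj.
    by rewrite subrr mulr0.
  have : rtr (gram Om) = rtr (gram a) + rtr (gram b) + 2 * complex.Re (\sum_i \sum_j (a i j)^* * b i j).
    rewrite !rtr_gram Re_sum mulr_sumr -!big_split; apply: eq_bigr => i _ /=.
    rewrite Re_sum mulr_sumr -!big_split; apply: eq_bigr => j _ /=.
    rewrite {1}eOm /madd; case: (a i j) (b i j) => x y [x' y'].
    by rewrite /nsq /=; ring.
  rewrite orth ra {1}rtr_gram Om1 /= mulr0 addr0; lra.
have beta0 : 0 <= beta by rewrite -rb; exact/rtr_ge0/gram_psd.
have beta_eps : beta <= eps by rewrite ebeta lerBlDr -lerBlDl.
have eps0 : 0 <= eps by exact: le_trans beta_eps.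
have vpos : 0 < 1 - beta.
  have h14 : 1 / 4 < 1 :> R by lra.
  by rewrite subr_gt0 (le_lt_trans beta_eps) // (lt_trans eps4).
pose w := rscale (1 - beta)^-1 (gram v).
have hw : psd w by apply: psd_rscale => //; rewrite invr_ge0 ltW.
have rw : rtr w = 1.
  rewrite /w rtr_rscale; have -> : rtr (gram v) = 1 - beta by rewrite -ra ga rtr_kron // (rtr_gram phi) phi1 mul1r.
  by rewrite mulVf // lt0r_neq0.
pose sg := kron (gram phi) w.
have hsg : psd sg by exact: psd_kron.
have rsg : rtr sg = 1 by rewrite rtr_kron // rw rtr_gram phi1 mulr1.
have gas : gram a = rscale (1 - beta) sg.
  rewrite ga; apply: mxext => i j; rewrite /rscale /sg /kron /w /rscale.
  have : (1 - beta)%:C%C * ((1 - beta)^-1)%:C%C = 1 :> C.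
    by rewrite -(rmorphM (real_complex R)) /= mulfV // lt0r_neq0.
  set x := gram phi _ _; set y := gram v _ _; move=> h.
  by transitivity ((1 - beta)%:C%C * ((1 - beta)^-1)%:C%C * (x * y)); [rewrite h mul1r|ring].
(* For [eps = 0] the weight [s^-1] would be meaningless; but then [b = 0] and both defects
   vanish. *)
have [e0|en] := eqVneq eps 0.
  have b0 : beta = 0 by apply/eqP; rewrite eq_le beta0 andbT -e0.
  have b00 : b = fun _ _ => 0.
    have hs : forall i, \sum_j nsq (b i j) = 0.
      have tot : \sum_i \sum_j nsq (b i j) = 0 by rewrite -rtr_gram rb.
      move=> i; apply: (psumr_eq0P _ tot) => // k _.
      by rewrite sumr_ge0 // => l _; exact: nsq_ge0.
    apply: mxext => i j; apply/eqP; rewrite -nsq_eq0; apply/eqP.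
    apply: (psumr_eq0P _ (hs i)) => // k _; exact: nsq_ge0.
  exists w, (rscale 0 sg), (rscale 0 sg); split=> //; try exact: psd_rscale.
  rewrite rtr_rscale e0 sqrtr0 mul0r mulr0; split=> //.
  rewrite -/sg; congr madd; rewrite eOm b00.
  have -> : madd a (fun _ _ => 0) = a by apply: mxext => i j; rewrite /madd addr0.
  by rewrite gas b0; apply: mxext => i j; rewrite /rscale subr0 mul1r.
have {}eps0 : 0 < eps by rewrite lt_def en.
set r := Num.sqrt eps.
have r0 : 0 < r by rewrite sqrtr_gt0.
have r2 : r ^+ 2 = eps by rewrite sqr_sqrtr // ltW.
have r14 : r ^+ 2 < 1 / 4 by rewrite r2.
have br2 : beta <= r ^+ 2 by rewrite r2.
pose s := Num.sqrt r.
have s0 : 0 < s by rewrite sqrtr_gt0.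
have s2 : s ^+ 2 = r by rewrite sqr_sqrtr // ltW.
have ss : s * s^-1 = 1 by rewrite mulfV // lt0r_neq0.
have id := gram_parallelogram a b ss; rewrite -eOm s2 exprVn s2 in id.
set T1 := gram (madd (rscale s a) (rscale (- s^-1) b)) in id.
have hT1 : psd T1 by exact: gram_psd.
have rT1 : rtr T1 = r * (1 - beta) + r^-1 * beta.
  have := congr1 (@rtr R _) id; rewrite !rtr_madd !rtr_rscale ra rb rtr_gram Om1.
  lra.
have br : r^-1 * beta <= r.
  by rewrite mulrC ler_pdivrMr // -expr2 r2.
(* [T1] has trace at most [2 * r]; adding [k] times [sg] to both sides makes the two defects have
   trace exactly [4 * r]. *)
pose k := 4 * r - rtr T1.
have k0 : 0 <= k.
  have rb0 : 0 <= r * beta by rewrite mulr_ge0 // ltW.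
  rewrite /k rT1 subr_ge0; apply: (@le_trans _ _ (r + r)); last by lra.
  by rewrite lerD // mulrBr mulr1 gerBl.
(* What remains of the parallelogram identity after one copy of [sg] is removed: [(1 + r) * (1 -
   beta) - 1 = r - beta - r * beta]. *)
pose T2 := madd (rscale (r - beta - r * beta) sg) (rscale (1 + r^-1) (gram b)).
have hT2 : psd T2.
  apply: psd_madd; apply: psd_rscale => //; last exact: gram_psd.
    exact: defect_coef_ge0.
  by rewrite addr_ge0 // invr_ge0 ltW.
have id2 : madd (gram Om) T1 = madd sg T2.
  rewrite id gas; apply: mxext => i j; rewrite /madd /T2 /madd /rscale.
  rewrite !(rmorphD (real_complex R), rmorphB (real_complex R), rmorphM (real_complex R), rmorph1) /=.
  by ring.
exists w, (madd T2 (rscale k sg)), (madd T1 (rscale k sg)); split=> //.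
- by apply: psd_madd => //; exact: psd_rscale.
- by apply: psd_madd => //; exact: psd_rscale.
have h1 : rtr (madd T1 (rscale k sg)) = 4 * r by rewrite rtr_madd rtr_rscale rsg /k; ring.
have h2 : madd (gram Om) (madd T1 (rscale k sg)) = madd sg (madd T2 (rscale k sg)).
  by rewrite (maddA (gram Om)) id2 -(maddA sg).
split=> //.
have := congr1 (@rtr R _) h2; rewrite rtr_madd [in RHS]rtr_madd h1 rsg rtr_gram Om1.
lra.
Qed.

End PureState.

(** The defects have trace [d = 4 * Num.sqrt eps], and [Delta x n] is the continuity bound at
    [d = 2 * x]; this is where the argument [2 * Num.sqrt eps] comes from. *)
Lemma near_product_centropy (Q X E Zr Et : finType) (phi : mx (Q * X) Zr)
    (Om : mx ((Q * X) * E) (Zr * Et)) (eps : R) :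
  \sum_i \sum_j nsq (phi i j) = 1 -> \sum_i \sum_j nsq (Om i j) = 1 -> eps < 1 / 4 ->
  1 - eps <= \sum_e \sum_et nsq (\sum_z \sum_r (phi z r)^* * Om (z, e) (r, et)) ->
  `|centropy (assoc (gram Om)) - centropy (gram phi)| <=
    Delta (2 * Num.sqrt eps) (log2 #|Q|%:R).
Proof.
move=> h1 h2 h3 h4.
have [w [T [T' [hw rw hT hT' [rT rT' e]]]]] := near_product_majorant h1 h2 h3 h4.
have hphi : psd (gram phi) by exact: gram_psd.
rewrite -(centropy_assoc_kron hphi hw rw).
have hk := psd_kron hphi hw.
have := @centropy_continuity_abs _ _ (assoc (gram Om)) (assoc (kron (gram phi) w)) (assoc T) (assoc T')
  (4 * Num.sqrt eps) (psd_assoc (gram_psd Om)) (psd_assoc hk) (psd_assoc hT) (psd_assoc hT').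
rewrite !rtr_assoc rtr_kron // !rtr_gram h1 h2 rw mulr1 => /(_ erefl erefl rT rT').
have -> : madd (assoc (gram Om)) (assoc T') = assoc (madd (gram Om) T') by [].
rewrite e => /(_ erefl); congr (_ <= _); rewrite /Delta.
have -> : 2 * (2 * Num.sqrt eps) = 4 * Num.sqrt eps by ring.
by congr (_ + _); ring.
Qed.

End Decoupling.

(** * The protocol *)

Section Isometries.
Variable R : realType.
Local Notation C := (R[i]).
Local Notation mx := (mx R).
Local Notation lmap := (lmap R).

Lemma isometry_dot (I J : finType) (W : mx J I) (x y : I -> C) : isometry W ->
  \sum_j (\sum_i W j i * x i) * (\sum_i W j i * y i)^* = \sum_i x i * (y i)^*.
Proof.
move=> hW; pose X : mx I unit := fun i _ => x i; pose Y : mx I unit := fun i _ => y i.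
transitivity (mxmul (adj (mxmul W Y)) (mxmul W X) tt tt).
  by apply: eq_bigr => j _; rewrite mulrC.
rewrite adjM -mxmulA (mxmulA (adj W)) hW mxmul1l.
by apply: eq_bigr => i _; rewrite mulrC.
Qed.

Lemma isometry_dotP (I J : finType) (W : mx J I) :
  (forall i i', \sum_j W j i * (W j i')^* = (i == i')%:R) -> isometry W.
Proof.
move=> h; apply: mxext => i i'; rewrite /idm eq_sym -h.
by apply: eq_bigr => j _; rewrite mulrC.
Qed.

Definition stinespring (I J E : finType) (n : E -> mx J I) : mx (J * E) I :=
  fun p i => n p.2 p.1 i.

Lemma stinespring_isometry (I J E : finType) (n : E -> mx J I) :
  (forall i i', \sum_e \sum_j (n e j i)^* * n e j i' = (i == i')%:R) ->
  isometry (stinespring n).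
Proof.
move=> h; apply: mxext => i i'; rewrite /mxmul sum_pair exchange_big.
exact: h.
Qed.

Lemma isometry_reindex (I J J' : finType) (W : mx J I) (f : J' -> J) :
  bijective f -> isometry W -> isometry (fun j i => W (f j) i).
Proof.
move=> bf hW; apply: etrans hW; apply: mxext => i i'.
by rewrite /mxmul [RHS](reindex f) //; exact: onW_bij.
Qed.

Lemma gram_reindex (I K K' : finType) (Y : mx I K) (f : K' -> K) :
  bijective f -> gram (fun i k => Y i (f k)) = gram Y.
Proof.
by move=> bf; apply: mxext => i i'; rewrite !gramE [RHS](reindex f) //; exact: onW_bij.
Qed.

Lemma tens_idm_mul (Q X Y K : finType) (W : mx Y X) (F : mx (Q * X) K) q y k :
  mxmul (kron (@idm R Q) W) F (q, y) k = \sum_x W y x * F (q, x) k.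
Proof.
rewrite /mxmul sum_pair -[RHS](sum_deltal (fun q => \sum_x W y x * F (q, x) k)).
apply: eq_bigr => q' _; rewrite mulr_sumr; apply: eq_bigr => x _.
by rewrite /kron /idm /= mulrA.
Qed.

Lemma conj_right_gram (Q X Y K : finType) (W : mx Y X) (F : mx (Q * X) K) :
  conj_right W (gram F) = gram (mxmul (kron (@idm R Q) W) F).
Proof. exact: conjmx_gram. Qed.

Lemma mtrace_conjmx (I J : finType) (W : mx J I) (X : mx I I) :
  isometry W -> mtrace (conjmx W X) = mtrace X.
Proof. by move=> hW; rewrite /conjmx mtrace_mulC mxmulA hW mxmul1l. Qed.

Lemma rtr_conj_right (Q X Y : finType) (W : mx Y X) (rho : mx (Q * X) (Q * X)) :
  isometry W -> rtr (conj_right W rho) = rtr rho.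
Proof. by move=> hW; rewrite /rtr mtrace_conjmx //; exact: isometry_tens. Qed.

Lemma sum_nsq_conj (I : finType) (x : I -> C) :
  \sum_i x i * (x i)^* = (\sum_i nsq (x i))%:C%C.
Proof. by rewrite real_sum; apply: eq_bigr => i _; exact: mul_conj. Qed.

Lemma gram_mulr (I K K' : finType) (X : mx I K) (M : mx K K') :
  gram M = @idm R K -> gram (mxmul X M) = gram X.
Proof. by move=> hM; rewrite /gram adjM -mxmulA (mxmulA M) -/(gram M) hM mxmul1l. Qed.

Section Protocol.
Variables (Q A B L Rr Ka Ma Kb Mb P' B' EV EV' EW EW' : finType).
Variables (nV : EV -> mx (Ka * Mb) (A * L)) (nV' : EV' -> mx (Ma * Kb) (Rr * B)).
Variables (nW : EW -> mx A (Ka * Ma)) (nW' : EW' -> mx B (Kb * Mb)).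
Hypotheses (iV : isometry (stinespring nV)) (iV' : isometry (stinespring nV')).
Hypotheses (iW : isometry (stinespring nW)) (iW' : isometry (stinespring nW')).
Variables (Yp : mx (Q * A) P') (Yb : mx B B') (psi : L * Rr -> C).
Hypotheses (Yp1 : \sum_i \sum_k nsq (Yp i k) = 1) (Yb1 : \sum_i \sum_k nsq (Yb i k) = 1).
Hypothesis psi1 : unit_vector psi.

(* Pure state before Bob acts: Q and P' purify Alice's input, EV is the
   environment of her operation. *)
Definition alice_state : mx (Q * (Ka * Rr)) (P' * (Mb * EV)) := fun x y =>
  \sum_(i : A * L) nV y.2.2 (x.2.1, y.2.1) i * (Yp (x.1, i.1) y.1 * psi (i.2, x.2.2)).

(* Bob's operation with the purified input Yb absorbed: an isometry from the
   resource R to (M_a, (K_b, (environment, purification))). *)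
Definition bob_iso : mx (Ma * (Kb * (EV' * B'))) Rr := fun z r =>
  \sum_b nV' z.2.2.1 (z.1, z.2.1) (r, b) * Yb b z.2.2.2.

(** Alice's isometry does not touch the resource half [Rr], so its reduced state is still that of
    [psi]. *)
Lemma alice_state_marginal : ptr1 (ptr1 (gram alice_state)) = ptr1 (pure psi).
Proof.
apply: mxext => r r'.
pose x r q p (i : A * L) : C := Yp (q, i.1) p * psi (i.2, r).
transitivity (\sum_q \sum_p \sum_i x r q p i * (x r' q p i)^*).
  rewrite /ptr1 exchange_big; apply: eq_bigr => q _ /=.
  under eq_bigr do rewrite gramE sum_pair.
  rewrite exchange_big; apply: eq_bigr => p _ /=.
  rewrite -(isometry_dot _ _ iV) sum_pair sum_pair; apply: eq_bigr => ka _ /=.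
  by rewrite sum_pair.
transitivity (\sum_q \sum_p \sum_a Yp (q, a) p * (Yp (q, a) p)^* *
    \sum_l psi (l, r) * (psi (l, r'))^*).
  apply: eq_bigr => q _; apply: eq_bigr => p _; rewrite sum_pair; apply: eq_bigr => a _.
  rewrite mulr_sumr; apply: eq_bigr => l _; rewrite /x /= conjM; ring.
under eq_bigr do under eq_bigr do rewrite -mulr_suml.
under eq_bigr do rewrite -mulr_suml.
rewrite -mulr_suml -[RHS]mul1r; congr (_ * _).
transitivity ((\sum_i \sum_k nsq (Yp i k))%:C%C : C); last by rewrite Yp1.
rewrite real_sum sum_pair; apply: eq_bigr => q _; rewrite exchange_big.
by apply: eq_bigr => a _; rewrite -sum_nsq_conj.
Qed.

Lemma rtr_alice_state : rtr (gram alice_state) = 1.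
Proof.
rewrite -rtr_ptr1 -rtr_ptr1 alice_state_marginal rtr_ptr1 /rtr.
suff -> : mtrace (pure psi) = 1 by [].
by rewrite -psi1; apply: eq_bigr => i _; rewrite mulrC.
Qed.

Lemma bob_isometry : isometry bob_iso.
Proof.
apply: isometry_dotP => r r'.
pose x r b' (i : Rr * B) : C := (r == i.1)%:R * Yb i.2 b'.
have bobE z r0 : bob_iso z r0 =
    \sum_i stinespring nV' ((z.1, z.2.1), z.2.2.1) i * x r0 z.2.2.2 i.
  rewrite sum_pair /bob_iso -[LHS](sum_deltal (fun r1 => \sum_b nV' z.2.2.1 (z.1, z.2.1) (r1, b) * Yb b z.2.2.2)).
  apply: eq_bigr => r1 _; rewrite mulr_sumr; apply: eq_bigr => b _.
  by rewrite /x /stinespring /=; ring.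
transitivity (\sum_b' \sum_i x r b' i * (x r' b' i)^*).
  transitivity (\sum_b' \sum_(j : (Ma * Kb) * EV')
      (\sum_i stinespring nV' j i * x r b' i) * (\sum_i stinespring nV' j i * x r' b' i)^*).
    rewrite exchange_big sum_pair [RHS]sum_pair [RHS]sum_pair; apply: eq_bigr => ma _.
    rewrite sum_pair; apply: eq_bigr => kb _; rewrite sum_pair; apply: eq_bigr => e _.
    by apply: eq_bigr => b' _; rewrite !bobE.
  by apply: eq_bigr => b' _; rewrite isometry_dot.
transitivity (\sum_b' \sum_b (r == r')%:R * (Yb b b' * (Yb b b')^*)).
  apply: eq_bigr => b' _; rewrite sum_pair exchange_big; apply: eq_bigr => b _ /=.
  rewrite -[RHS](sum_deltal (fun r1 => (r1 == r')%:R * (Yb b b' * (Yb b b')^*))).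
  by apply: eq_bigr => r1 _; rewrite /x /= conjM conjCn (eq_sym r'); ring.
rewrite exchange_big; under eq_bigr do rewrite -mulr_sumr sum_nsq_conj.
by rewrite -mulr_sumr -real_sum Yb1 mulr1.
Qed.

Definition bob_iso_ext : mx ((Ka * Ma) * (Kb * (EV' * B'))) (Ka * Rr) := fun z x =>
  kron (@idm R Ka) bob_iso (z.1.1, (z.1.2, z.2)) x.

Lemma bob_isometry_ext : isometry bob_iso_ext.
Proof.
apply: (@isometry_reindex _ _ _ (kron (@idm R Ka) bob_iso) (fun z => (z.1.1, (z.1.2, z.2)))).
  by exists (fun z => ((z.1, z.2.1), z.2.2)) => [[[]]|[? []]].
exact/isometry_tens/bob_isometry.
Qed.

Lemma bob_iso_extE ka ma y (F : Ka * Rr -> C) :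
  \sum_x bob_iso_ext ((ka, ma), y) x * F x = \sum_r bob_iso (ma, y) r * F (ka, r).
Proof.
rewrite sum_pair -[RHS](sum_deltal (fun k => \sum_r bob_iso (ma, y) r * F (k, r))).
apply: eq_bigr => k _; rewrite mulr_sumr; apply: eq_bigr => r _.
by rewrite /bob_iso_ext /kron /idm /= mulrA.
Qed.

(** Rows hold the reference and what Alice has after the exchange; columns hold Bob's systems, the
    purifications and the environments. *)
Definition round_state : mx (Q * (Ka * Ma)) ((Kb * Mb) * ((P' * B') * (EV * EV'))) := fun x y =>
  \sum_r bob_iso (x.2.2, (y.1.1, (y.2.2.2, y.2.1.2))) r *
         alice_state (x.1, (x.2.1, r)) (y.2.1.1, (y.1.2, y.2.2.1)).

Lemma gram_round_state :
  gram round_state = ptr_last (conj_right bob_iso_ext (gram alice_state)).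
Proof.
apply: mxext => -[q [ka ma]] [q' [ka' ma']]; rewrite conj_right_gram /ptr_last /=.
pose h (y : (Kb * (EV' * B')) * (P' * (Mb * EV))) : (Kb * Mb) * ((P' * B') * (EV * EV')) :=
  ((y.1.1, y.2.2.1), ((y.2.1, y.1.2.2), (y.2.2.2, y.1.2.1))).
have bh : bijective h.
  exists (fun z => ((z.1.1, (z.2.2.2, z.2.1.2)), (z.2.1.1, (z.1.2, z.2.2.1)))).
    by move=> [[? [? ?]] [? [? ?]]].
  by move=> [[? ?] [[? ?] [? ?]]].
rewrite -(gram_reindex _ bh) gramE sum_pair; apply: eq_bigr => y _.
rewrite gramE; apply: eq_bigr => k _; rewrite !tens_idm_mul !bob_iso_extE.
by case: y k => ? [? ?] [? [? ?]].
Qed.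

(** Once [Ma] is discarded, the whole output of Bob's isometry is traced out, and the reference with
    [Ka] is as before he acted. *)
Lemma ptr_last_round_state : ptr_last (gram round_state) = ptr_last (gram alice_state).
Proof.
rewrite gram_round_state conj_right_gram; apply: mxext => -[q ka] [q' ka']; rewrite /ptr_last /=.
transitivity (\sum_k \sum_r alice_state (q, (ka, r)) k * (alice_state (q', (ka', r)) k)^*); last first.
  by rewrite exchange_big.
transitivity (\sum_k \sum_z (\sum_r bob_iso z r * alice_state (q, (ka, r)) k) *
                            (\sum_r bob_iso z r * alice_state (q', (ka', r)) k)^*).
  rewrite [RHS]exchange_big [RHS]sum_pair; apply: eq_bigr => ma _; apply: eq_bigr => y _.
  by rewrite gramE; apply: eq_bigr => k _; rewrite !tens_idm_mul !bob_iso_extE.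
by apply: eq_bigr => k _; rewrite isometry_dot //; exact: bob_isometry.
Qed.

Lemma centropy_round_state_le : centropy (gram round_state) <= centropy (ptr_last (gram alice_state)).
Proof. by rewrite -ptr_last_round_state; exact/strong_subadditivity/gram_psd. Qed.

Lemma centropy_round_state_ge :
  centropy (ptr_last (gram alice_state)) - 2 * entropy (ptr1 (pure psi)) <= centropy (gram round_state).
Proof.
rewrite gram_round_state -alice_state_marginal.
apply: (@le_trans _ _ (centropy (gram alice_state))).
  by apply: centropy_ptr_last_ge; [exact: gram_psd|exact: rtr_alice_state].
(* Conditioning on [Ka] and [Rr] equals conditioning on [Ka] and the full output of Bob's isometry;
   all of it but [Ma] is then discarded. *)
rewrite -(centropy_conj_right bob_isometry_ext (gram_psd _)).
exact/strong_subadditivity/psd_conj_right/gram_psd.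
Qed.

(** Alice's last isometry acts on rows and Bob's on columns, where it enters transposed. *)
Definition final_state' : mx (Q * (A * EW)) ((B * EW') * ((P' * B') * (EV * EV'))) :=
  mxmul (mxmul (kron (@idm R Q) (stinespring nW)) round_state)
        (kron (trm (stinespring nW')) (@idm R _)).

Lemma gram_final_state' : gram final_state' = conj_right (stinespring nW) (gram round_state).
Proof.
rewrite conj_right_gram; apply: gram_mulr.
have e : gram (trm (stinespring nW')) = @idm R _.
  by rewrite gram_trm iW'; apply: mxext => i j; rewrite /cjm /idm conjCn.
by rewrite /gram kron_adj kron_mul adj_idm mxmul1l -/(gram _) e kron_idm.
Qed.

(** Regrouped so that the environments form separate tensor factors on both sides, as the comparison
    with a product vector requires. *)
Definition final_state : mx ((Q * A) * EW) (((P' * B') * B) * ((EV * EV') * EW')) := fun x y =>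
  final_state' (x.1.1, (x.1.2, x.2)) ((y.1.2, y.2.2), (y.1.1, y.2.1)).

Lemma assoc_gram_final_state : assoc (gram final_state) = conj_right (stinespring nW) (gram round_state).
Proof.
rewrite -gram_final_state'.
pose h (y : ((P' * B') * B) * ((EV * EV') * EW')) : (B * EW') * ((P' * B') * (EV * EV')) :=
  ((y.1.2, y.2.2), (y.1.1, y.2.1)).
have bh : bijective h.
  by exists (fun z => ((z.2.1, z.1.1), (z.2.2, z.1.2))) => [[[? ?] [? ?]]|[[? ?] [? ?]]].
by rewrite -(gram_reindex _ bh); apply: mxext => -[q [a e]] [q' [a' e']].
Qed.

Lemma rtr_final_state : rtr (gram final_state) = 1.
Proof.
rewrite -rtr_assoc assoc_gram_final_state rtr_conj_right // gram_round_state.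
rewrite /rtr mtrace_ptr_last -/(rtr _) rtr_conj_right; first exact: rtr_alice_state.
exact: bob_isometry_ext.
Qed.

Lemma centropy_final_state :
  centropy (assoc (gram final_state)) = centropy (gram round_state).
Proof. by rewrite assoc_gram_final_state centropy_conj_right //; exact: gram_psd. Qed.

End Protocol.
End Isometries.

(** * Comparison with the ideal evolution, and the bound *)

Section Assembly.
Variable R : realType.
Local Notation C := (R[i]).
Local Notation mx := (mx R).
Local Notation lmap := (lmap R).

(** One operator for each joint index of the four environments; column [i] is the outcome on the
    basis input [i] with [psi] attached. *)
Definition nlqc_kraus (A B L Rr Ka Ma Kb Mb EV EV' EW EW' : finType)
  (nV : EV -> mx (Ka * Mb) (A * L)) (nV' : EV' -> mx (Ma * Kb) (Rr * B))
  (nW : EW -> mx A (Ka * Ma)) (nW' : EW' -> mx B (Kb * Mb)) (psi : L * Rr -> C)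
  (k : (unit * (EV * EV')) * (EW * EW')) : mx (A * B) (A * B) := fun p i =>
  tens_vec nW nW' (fun k1 z =>
    tens_vec nV nV' (fun (_ : unit) w => ((w.1.1 == i.1) && (w.2.2 == i.2))%:R * psi (w.1.2, w.2.1))
      k1 ((z.1.1, z.2.2), (z.1.2, z.2.1))) k p.

Lemma kraus_nlqc (A B L Rr Ka Ma Kb Mb EV EV' EW EW' : finType) (psi : L * Rr -> C)
  (V : lmap (A * L) (Ka * Mb)) (V' : lmap (Rr * B) (Ma * Kb))
  (W : lmap (Ka * Ma) A) (W' : lmap (Kb * Mb) B)
  (nV : EV -> mx (Ka * Mb) (A * L)) (nV' : EV' -> mx (Ma * Kb) (Rr * B))
  (nW : EW -> mx A (Ka * Ma)) (nW' : EW' -> mx B (Kb * Mb)) :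
  kraus_of V nV -> kraus_of V' nV' -> kraus_of W nW -> kraus_of W' nW' ->
  kraus_of (nlqc (pure psi) V V' W W') (nlqc_kraus nV nV' nW nW' psi).
Proof.
move=> hV hV' hW hW' i i' j j'; apply: (tens_kraus hW hW') => p q.
apply: (tens_kraus hV hV') => {}p {}q; rewrite (big_pred1 tt) => [|[]] //.
rewrite /nlqc_in /ebasis /pure conjM conjCn.
case: i i' => [a b] [a' b']; rewrite !xpair_eqE /=.
by rewrite -mulnb natrM; ring.
Qed.

Lemma mul_tens_idm (I K K' E : finType) (F : mx I (K * E)) (M : mx K K') i k e :
  mxmul F (kron M (@idm R E)) i (k, e) = \sum_x F i (x, e) * M x k.
Proof.
rewrite /mxmul sum_pair; apply: eq_bigr => x _.
rewrite -[RHS](sum_deltar (fun e => F i (x, e) * M x k)); apply: eq_bigr => e' _.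
by rewrite /kron /idm /= mulrA.
Qed.

(** Links the two descriptions of the protocol: the amplitudes of the dilated run are the Kraus
    operators of the channel applied to the purified input. *)
Lemma final_stateE (Q A B L Rr Ka Ma Kb Mb P' B' EV EV' EW EW' : finType)
  (nV : EV -> mx (Ka * Mb) (A * L)) (nV' : EV' -> mx (Ma * Kb) (Rr * B))
  (nW : EW -> mx A (Ka * Ma)) (nW' : EW' -> mx B (Kb * Mb))
  (Yp : mx (Q * A) P') (Yb : mx B B') (psi : L * Rr -> C) q a ec p b' b e e' ed :
  final_state nV nV' nW nW' Yp Yb psi ((q, a), ec) (((p, b'), b), ((e, e'), ed)) =
  \sum_j nlqc_kraus nV nV' nW nW' psi ((tt, (e, e')), (ec, ed)) (a, b) j *
         (Yp (q, j.1) p * Yb j.2 b').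
Proof.
pose rs z := round_state nV nV' Yp Yb psi (q, z.1) (z.2, ((p, b'), (e, e'))).
transitivity (\sum_(z : (Ka * Ma) * (Kb * Mb)) nW ec a z.1 * nW' ed b z.2 * rs z).
  rewrite /final_state /final_state' /= mul_tens_idm [RHS]sum_pair [RHS]exchange_big /=.
  apply: eq_bigr => z2 _; rewrite tens_idm_mul mulr_suml; apply: eq_bigr => z1 _.
  by rewrite /rs /trm /stinespring /=; ring.
rewrite /nlqc_kraus /tens_vec /=; under [RHS]eq_bigr do rewrite mulr_suml.
rewrite exchange_big; apply: eq_bigr => -[[ka ma] [kb mb]] _ /=.
under [RHS]eq_bigr do rewrite -mulrA.
rewrite -[RHS]mulr_sumr; congr (_ * _).
under eq_bigr do rewrite mulr_suml; rewrite exchange_big.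
rewrite /rs /round_state /= sum_pair.
transitivity (\sum_(w : A * L) \sum_(u : Rr * B)
   nV e (ka, mb) w * nV' e' (ma, kb) u * psi (w.2, u.1) * (Yp (q, w.1) p * Yb u.2 b')).
  under [RHS]eq_bigr do rewrite sum_pair; rewrite [RHS]exchange_big; apply: eq_bigr => r _.
  rewrite /bob_iso /alice_state mulr_suml [RHS]exchange_big; apply: eq_bigr => b1 _.
  by rewrite mulr_sumr; apply: eq_bigr => w _ /=; ring.
apply: eq_bigr => w _; apply: eq_bigr => u _ /=.
rewrite -(sum_deltal (fun i : A * B => nV e (ka, mb) w * nV' e' (ma, kb) u * psi (w.2, u.1) * (Yp (q, i.1) p * Yb i.2 b')) (w.1, u.2)).
by apply: eq_bigr => -[i j] _; rewrite xpair_eqE /=; ring.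
Qed.

Section OneInput.
Variables (A B L Rr Ka Ma Kb Mb EV EV' EW EW' : finType).
Variables (V : lmap (A * L) (Ka * Mb)) (V' : lmap (Rr * B) (Ma * Kb)).
Variables (W : lmap (Ka * Ma) A) (W' : lmap (Kb * Mb) B).
Variables (nV : EV -> mx (Ka * Mb) (A * L)) (nV' : EV' -> mx (Ma * Kb) (Rr * B)).
Variables (nW : EW -> mx A (Ka * Ma)) (nW' : EW' -> mx B (Kb * Mb)).
Hypotheses (kV : kraus_of V nV) (kV' : kraus_of V' nV').
Hypotheses (kW : kraus_of W nW) (kW' : kraus_of W' nW').
Hypotheses (iV : isometry (stinespring nV)) (iV' : isometry (stinespring nV')).
Hypotheses (iW : isometry (stinespring nW)) (iW' : isometry (stinespring nW')).
Variables (U : mx (A * B) (A * B)) (psi : L * Rr -> C) (eps : R).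
Hypotheses (hU : unitary U) (psi1 : unit_vector psi) (eps4 : eps < 1 / 4).
Hypothesis close : diamond_close (nlqc (pure psi) V V' W W') (uchan U) eps.
Variables (Yp : mx (A * A) (A * A)) (Yb : mx B B).
Hypotheses (Yp1 : rtr (gram Yp) = 1) (Yb1 : rtr (gram Yb) = 1).

(** The purified input; [s] collects the reference and both purifying systems, which together serve
    as the ancilla of the diamond distance. *)
Let xi (s : A * ((A * A) * B)) (j : A * B) : C := Yp (s.1, j.1) s.2.1 * Yb j.2 s.2.2.

Definition ideal_state : mx (A * A) (((A * A) * B) * B) := fun x y =>
  \sum_j U (x.2, y.2) j * (Yp (x.1, j.1) y.1.1 * Yb j.2 y.1.2).

Lemma gram_ideal_state : gram ideal_state = ptr2 (evolve U (gram Yp) (gram Yb)).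
Proof.
pose W0 : mx ((A * A) * B) ((A * A) * B) :=
  fun p q => (p.1.1 == q.1.1)%:R * U (p.1.2, p.2) (q.1.2, q.2).
have -> : evolve U (gram Yp) (gram Yb) = gram (mxmul W0 (kron Yp Yb)).
  rewrite /evolve -/W0 -conjmx_gram /conjmx; congr (mxmul (mxmul _ _) _).
  by rewrite /gram kron_adj kron_mul.
have e q a b y : mxmul W0 (kron Yp Yb) ((q, a), b) y = ideal_state (q, a) (y, b).
  rewrite /mxmul sum_pair sum_pair /ideal_state /=.
  rewrite -[RHS](sum_deltal (fun q => \sum_j U (a, b) j * (Yp (q, j.1) y.1 * Yb j.2 y.2))).
  apply: eq_bigr => q' _; rewrite sum_pair mulr_sumr; apply: eq_bigr => a' _.
  by rewrite mulr_sumr; apply: eq_bigr => b'' _; rewrite /W0 /kron /=; ring.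
apply: mxext => -[q a] [q' a']; rewrite gramE sum_pair exchange_big /ptr2.
by apply: eq_bigr => b _; rewrite gramE; apply: eq_bigr => y _; rewrite !e.
Qed.

Lemma xi_dot q q' : \sum_y \sum_j xi (q, y) j * (xi (q', y) j)^* = ptr2 (gram Yp) q q'.
Proof.
transitivity (\sum_p \sum_b' \sum_a \sum_b (Yp (q, a) p * (Yp (q', a) p)^*) * (Yb b b' * (Yb b b')^*)).
  rewrite sum_pair; apply: eq_bigr => p _; apply: eq_bigr => b' _; rewrite sum_pair.
  by apply: eq_bigr => a _; apply: eq_bigr => b _; rewrite /xi /= conjM; ring.
have hb : \sum_b' \sum_b Yb b b' * (Yb b b')^* = 1.
  rewrite exchange_big; transitivity ((rtr (gram Yb))%:C%C : C); last by rewrite Yb1.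
  rewrite rtr_gram real_sum; apply: eq_bigr => b _; exact: sum_nsq_conj.
transitivity (\sum_p \sum_a Yp (q, a) p * (Yp (q', a) p)^*).
  apply: eq_bigr => p _; rewrite exchange_big; apply: eq_bigr => a _ /=.
  under eq_bigr do rewrite -mulr_sumr.
  by rewrite -mulr_sumr hb mulr1.
by rewrite exchange_big.
Qed.

Lemma ideal_state_marginal : ptr2 (gram ideal_state) = ptr2 (gram Yp).
Proof.
apply: mxext => q q'; rewrite -xi_dot /ptr2.
transitivity (\sum_y \sum_i (\sum_j U i j * xi (q, y) j) * (\sum_j U i j * xi (q', y) j)^*).
  under eq_bigr do rewrite gramE sum_pair.
  by rewrite exchange_big; apply: eq_bigr => y _; rewrite [RHS]sum_pair.
by apply: eq_bigr => y _; exact: isometry_dot.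
Qed.

Lemma rtr_ideal_state : rtr (gram ideal_state) = 1.
Proof. by rewrite -rtr_ptr2 ideal_state_marginal rtr_ptr2. Qed.

(** The sum over Kraus branches in the diamond estimate is the squared norm of the environment
    vector obtained by contracting the final vector with the ideal one. *)
Lemma final_state_near_ideal :
  `|centropy (assoc (gram (final_state nV nV' nW nW' Yp Yb psi))) - centropy (gram ideal_state)| <=
    Delta (2 * Num.sqrt eps) (log2 #|A|%:R).
Proof.
have Yp1' := Yp1; have Yb1' := Yb1; rewrite rtr_gram in Yp1'; rewrite rtr_gram in Yb1'.
apply: near_product_centropy => //.
- by rewrite -rtr_gram rtr_ideal_state.
- by rewrite -rtr_gram rtr_final_state.
have xi1 : \sum_s \sum_i nsq (xi s i) = 1.
  transitivity (rtr (ptr2 (gram Yp))); last by rewrite rtr_ptr2.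
  rewrite /rtr /mtrace Re_sum sum_pair; apply: eq_bigr => q _; rewrite -xi_dot Re_sum.
  by apply: eq_bigr => y _; rewrite sum_nsq_conj.
have := diamond_fidelity (kraus_nlqc psi kV kV' kW kW') hU xi1 close.
congr (_ <= _); rewrite sum_pair sum_pair (big_pred1 tt) => [|[]] //.
under [RHS]eq_bigr do rewrite sum_pair.
rewrite [RHS]exchange_big; apply: eq_bigr => -[e e'] _; rewrite sum_pair.
apply: eq_bigr => ec _; apply: eq_bigr => ed _ /=; congr nsq.
rewrite sum_pair [RHS]sum_pair; apply: eq_bigr => q _ /=.
under [RHS]eq_bigr do rewrite sum_pair.
rewrite [RHS]exchange_big; apply: eq_bigr => -[p b'] _ /=; rewrite sum_pair.
by apply: eq_bigr => a _; apply: eq_bigr => b _; rewrite final_stateE.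
Qed.

(** The reference value [c0] does not involve [Yb], so the bounds for different inputs of Bob can be
    combined. *)
Lemma centropy_evolve_bounds :
  let S := entropy (ptr1 (pure psi)) in
  let D := Delta (2 * Num.sqrt eps) (log2 #|A|%:R) in
  let c0 := centropy (ptr_last (gram (alice_state nV Yp psi))) in
  let c := centropy (ptr2 (evolve U (gram Yp) (gram Yb))) in
  c0 - 2 * S - D <= c /\ c <= c0 + D.
Proof.
have Yp1' := Yp1; have Yb1' := Yb1; rewrite rtr_gram in Yp1'; rewrite rtr_gram in Yb1'.
move=> S D c0 c.
have := final_state_near_ideal; rewrite gram_ideal_state -/c -/D.
rewrite centropy_final_state //.
have h1 : _ <= c0 := centropy_round_state_le nV iV' Yp psi Yb1'.
have h2 : c0 - 2 * S <= _ := centropy_round_state_ge iV iV' Yp1' Yb1' psi1.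
rewrite ler_norml => /andP[h3 h4]; split; lra.
Qed.

Lemma mutinfo_evolve : mutinfo (evolve U (gram Yp) (gram Yb)) =
  entropy (ptr2 (gram Yp)) - centropy (ptr2 (evolve U (gram Yp) (gram Yb))).
Proof.
rewrite /mutinfo /centropy -gram_ideal_state ideal_state_marginal; ring.
Qed.

End OneInput.
End Assembly.

Theorem mainTheorem4 (R : realType) (A B L Rr Ka Ma Kb Mb : finType)
  (U : mx R (A * B) (A * B)) (l1 l2 : R) (psi : L * Rr -> R[i])
  (V : lmap R (A * L) (Ka * Mb)) (V' : lmap R (Rr * B) (Ma * Kb))
  (W : lmap R (Ka * Ma) A) (W' : lmap R (Kb * Mb) B) (eps : R) :
  unitary U ->
  controllable_correlation U l1 l2 ->
  unit_vector psi ->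
  channel V -> channel V' -> channel W -> channel W' ->
  eps < 1 / 4 ->
  diamond_close (nlqc (pure psi) V V' W W') (uchan U) eps ->
  (l1 - l2) / 2 - Delta (2 * Num.sqrt eps) (log2 #|A|%:R)
    <= entropy (ptr1 (pure psi)).
Proof.
move=> hU [P [phi1 [phi2 [[hP h1 h2] [-> -> _]]]]] hpsi.
move=> /channel_kraus [nV [kV /stinespring_isometry iV]].
move=> /channel_kraus [nV' [kV' /stinespring_isometry iV']].
move=> /channel_kraus [nW [kW /stinespring_isometry iW]].
move=> /channel_kraus [nW' [kW' /stinespring_isometry iW']] eps4 close.
have state_gram (I : finType) (X : mx R I I) : state X -> exists Y : mx R I I, X = gram Y /\ rtr (gram Y) = 1.
  by move=> [/psd_gramP [Y ->] e]; exists Y; rewrite /rtr e.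
have [Yp [-> Yp1]] := state_gram _ _ hP.
have [Y1 [-> Y11]] := state_gram _ _ h1; have [Y2 [-> Y21]] := state_gram _ _ h2.
(* The larger mutual information means the smaller conditional entropy, so the first input takes the
   lower bound and the second the upper one. Then [c0] cancels, and [l1 - l2] is at most twice the
   entropy plus twice [Delta]. *)
have [a1 _] := centropy_evolve_bounds kV kV' kW kW' iV iV' iW iW' hU hpsi eps4 close Yp1 Y11.
have [_ a2] := centropy_evolve_bounds kV kV' kW kW' iV iV' iW iW' hU hpsi eps4 close Yp1 Y21.
rewrite !(mutinfo_evolve hU) //; lra.
Qed.
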